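(* There is a data structure (the hybrid tree) storing a set $S$ of $n$ keys as a binary search tree in which, in addition to the left-child, right-child and parent pointers and $O(1)$ extra fields per node, certain nodes carry one additional pointer, such that for every access sequence $X$ of keys of $S$ it serves $X$ in $O(\log\log n\cdot \mathrm{OPT}(X))$ time (i.e., it is $O(\log\log n)$-competitive) and each access takes $O(\log n)$ worst-case time, in the comparison-based pointer machine model.
   Context: BST model (Wilber): a binary search tree stores the keys of a fixed set $S$ of $n$ keys in symmetric order; each node has left child, right child and parent pointers and $O(1)$ additional fields of $O(\log n)$ bits, and no other pointers. An access starts at the root and moves a pointer along tree edges until it reaches the desired node, possibly updating touched nodes; its cost is the number of nodes touched. Access sequences consist only of successful accesses to keys of $S$. $\mathrm{OPT}(X)$ denotes the minimum total cost over all BST algorithms in this model of serving the access sequence $X$. A data structure is $f(n)$-competitive if it serves every $X$ in $O(f(n)\,\mathrm{OPT}(X))$ time.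
   Formalization: With a free initial tree for OPT the bound fails for very short X (a single access has OPT = 1), so it is proved for every X against OPT started from the structure's own initial tree, and against OPT with a free initial tree when X has at least n accesses; n is at least 4. *)

(* Defs.v *)
From mathcomp Require Import all_boot all_order.
From Stdlib Require Import ClassicalEpsilon.

Set Implicit Arguments.
Unset Strict Implicit.
Unset Printing Implicit Defensive.

Import Order.TTheory.

(** * Binary search trees; a node is identified with the key it stores *)

Inductive tree (K : Type) : Type :=
| Leaf
| Node of tree K & K & tree K.

Arguments Leaf {K}.

Fixpoint inorder (K : Type) (t : tree K) : seq K :=
  if t is Node l k r then inorder l ++ k :: inorder r else [::].

Definition root_key (K : Type) (t : tree K) : option K :=
  if t is Node _ k _ then Some k else None.

Definition bst (d : Order.disp_t) (K : finOrderType d) (t : tree K) : Prop :=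
  sorted <%O (inorder t) /\ forall k : K, k \in inorder t.

(** * Cost of serving a sequence in the BST model *)

(* [child t p q]: q is the left or the right child of p in t *)
Fixpoint child (K : eqType) (t : tree K) (p q : K) : bool :=
  if t is Node l k r then
    [|| (k == p) && ((root_key l == Some q) || (root_key r == Some q)),
        child l p q | child r p q]
  else false.

(* [rotation t x t']: t' is t after rotating x with its parent *)
Inductive rotation (K : Type) : tree K -> K -> tree K -> Prop :=
| rotation_right a x b y c :
    rotation (Node (Node a x b) y c) x (Node a x (Node b y c))
| rotation_left a y b x c :
    rotation (Node a y (Node b x c)) x (Node (Node a y b) x c)
| rotation_in_left l l' k r x :
    rotation l x l' -> rotation (Node l k r) x (Node l' k r)
| rotation_in_right l k r r' x :
    rotation r x r' -> rotation (Node l k r) x (Node l k r').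

(* [walk t p A t' q]: a pointer placed on p moves along tree edges and rotates
   the node it points to, any number of times, ending on q with t turned into
   t'; A is the set of nodes touched.  When the walk starts at the root, the
   parent involved in a rotation has always been touched already. *)
Inductive walk (K : finType) : tree K -> K -> {set K} -> tree K -> K -> Prop :=
| walk_stop t p : walk t p [set p] t p
| walk_move t p q A t' z :
    child t p q || child t q p -> walk t q A t' z -> walk t p (p |: A) t' z
| walk_rotate t p t1 A t' z :
    rotation t p t1 -> walk t1 p A t' z -> walk t p A t' z.

Definition bst_access (K : finType) (t : tree K) (x : K) (t' : tree K)
    (cost : nat) : Prop :=
  exists r A, [/\ root_key t = Some r, walk t r A t' x & cost = #|A|].

Inductive bst_serves (K : finType) : tree K -> seq K -> nat -> Prop :=
| bst_serves_nil t : bst_serves t [::] 0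
| bst_serves_cons t x t' a X m :
    bst_access t x t' a -> bst_serves t' X m ->
    bst_serves t (x :: X) (a + m).

Definition is_minimum (P : nat -> Prop) (m : nat) : Prop :=
  P m /\ forall m', P m' -> m <= m'.

(* meaningful when P is inhabited, see [minimumP] *)
Definition minimum (P : nat -> Prop) : nat :=
  epsilon (inhabits 0) (is_minimum P).

(* The first minimum is over the executions that start from the tree t; in the
   second one the initial tree is chosen freely, at no cost. *)
Definition OPT_from (K : finType) (t : tree K) (X : seq K) : nat :=
  minimum (bst_serves t X).

Definition OPT (d : Order.disp_t) (K : finOrderType d) (X : seq K) : nat :=
  minimum (fun m => exists2 t : tree K, bst t & bst_serves t X m).

(** * A comparison-based pointer machine *)

Inductive ptr_field := PLeft | PRight | PParent | PExtra.

Definition ptr_field_eqb (f g : ptr_field) : bool :=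
  match f, g with
  | PLeft, PLeft | PRight, PRight | PParent, PParent | PExtra, PExtra => true
  | _, _ => false
  end.

(* every node has four pointer fields (nil is None) and k integer fields *)
Record heap (k : nat) (K : Type) := Heap {
  ptr : ptr_field -> K -> option K;
  fld : 'I_k -> K -> nat }.

(* a given program mentions, hence uses, only finitely many registers *)
Record machine (k : nat) (K : Type) := Machine {
  preg : nat -> option K;
  wreg : nat -> nat;
  mem : heap k K }.

(* The key being searched is visible to a program only through [TSearchLt] and
   [TSearchEq], and keys stored in nodes only through comparisons. *)
Inductive test :=
| TNil of nat                (* preg p is nil *)
| TSame of nat & nat         (* preg p = preg q *)
| TKeyLt of nat & nat        (* key of preg p < key of preg q *)
| TSearchLt of nat           (* searched key < key of preg p *)
| TSearchEq of nat           (* searched key = key of preg p *)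
| TWordLt of nat & nat       (* wreg u < wreg v *)
| TNot of test
| TAnd of test & test.

Inductive instr (k : nat) :=
| INil of nat                      (* preg p := nil *)
| IMove of nat & nat               (* preg p := preg q *)
| ILoad of nat & nat & ptr_field   (* preg p := (preg q).f *)
| IStore of nat & ptr_field & nat  (* (preg p).f := preg q *)
| IConst of nat & nat              (* wreg w := m *)
| IAdd of nat & nat & nat          (* wreg w := wreg u + wreg v *)
| ISub of nat & nat & nat          (* wreg w := wreg u - wreg v, truncated *)
| IGet of nat & nat & 'I_k         (* wreg w := (preg p).i *)
| IPut of nat & 'I_k & nat.        (* (preg p).i := wreg w *)

Inductive cmd (k : nat) :=
| CInstr of instr k
| CSeq of cmd k & cmd k
| CIf of test & cmd k & cmd k
| CWhile of test & cmd k.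

Arguments INil {k}.
Arguments IMove {k}.
Arguments ILoad {k}.
Arguments IStore {k}.
Arguments IConst {k}.
Arguments IAdd {k}.
Arguments ISub {k}.

Definition upd (A : eqType) (B : Type) (f : A -> B) (a : A) (b : B) : A -> B :=
  fun a' => if a' == a then b else f a'.

Definition set_preg k (K : Type) (s : machine k K) (p : nat) (v : option K) :=
  Machine (upd (preg s) p v) (wreg s) (mem s).

(* words hold values below W; an operation that overflows is undefined *)
Definition set_wreg (W : nat) k (K : Type) (s : machine k K) (w m : nat) :=
  if m < W then Some (Machine (preg s) (upd (wreg s) w m) (mem s)) else None.

Definition set_ptr k (K : eqType) (s : machine k K) (f : ptr_field) (a : K)
    (v : option K) :=
  Machine (preg s) (wreg s)
    (Heap (fun g => if ptr_field_eqb g f then upd (ptr (mem s) g) a v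
                    else ptr (mem s) g)
          (fld (mem s))).

Definition set_fld k (K : eqType) (s : machine k K) (i : 'I_k) (a : K)
    (m : nat) :=
  Machine (preg s) (wreg s)
    (Heap (ptr (mem s)) (upd (fld (mem s)) i (upd (fld (mem s) i) a m))).

(* None when a nil pointer is dereferenced; [TAnd] is lazy *)
Fixpoint eval_test (d : Order.disp_t) (K : finOrderType d) (x : K) k
    (s : machine k K) (b : test) : option bool :=
  match b with
  | TNil p => Some (preg s p == None)
  | TSame p q => Some (preg s p == preg s q)
  | TKeyLt p q =>
      if preg s p is Some a then
        if preg s q is Some a' then Some (a < a')%O else None
      else None
  | TSearchLt p => if preg s p is Some a then Some (x < a)%O else None
  | TSearchEq p => if preg s p is Some a then Some (x == a) else None
  | TWordLt u v => Some (wreg s u < wreg s v)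
  | TNot b1 => omap negb (eval_test x s b1)
  | TAnd b1 b2 =>
      if eval_test x s b1 is Some v then
        if v then eval_test x s b2 else Some false
      else None
  end.

Definition eval_instr (W k : nat) (K : eqType) (s : machine k K) (i : instr k) :
    option (machine k K) :=
  match i with
  | INil p => Some (set_preg s p None)
  | IMove p q => Some (set_preg s p (preg s q))
  | ILoad p q f =>
      if preg s q is Some a then Some (set_preg s p (ptr (mem s) f a)) else None
  | IStore p f q =>
      if preg s p is Some a then Some (set_ptr s f a (preg s q)) else None
  | IConst w m => set_wreg W s w m
  | IAdd w u v => set_wreg W s w (wreg s u + wreg s v)
  | ISub w u v => set_wreg W s w (wreg s u - wreg s v)
  | IGet w p i =>
      if preg s p is Some a then set_wreg W s w (fld (mem s) i a) else None
  | IPut p i w =>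
      if preg s p is Some a then Some (set_fld s i a (wreg s w)) else None
  end.

(* [exec W x c s s' t]: started in s with searched key x, c halts in s' after
   t steps; every instruction and every evaluation of a test is one step. *)
Inductive exec (W : nat) (d : Order.disp_t) (K : finOrderType d) (x : K)
    (k : nat) : cmd k -> machine k K -> machine k K -> nat -> Prop :=
| exec_instr i s s' :
    eval_instr W s i = Some s' -> exec W x (CInstr i) s s' 1
| exec_seq c1 c2 s s1 s2 t1 t2 :
    exec W x c1 s s1 t1 -> exec W x c2 s1 s2 t2 ->
    exec W x (CSeq c1 c2) s s2 (t1 + t2)
| exec_if b c1 c2 v s s' t :
    eval_test x s b = Some v -> exec W x (if v then c1 else c2) s s' t ->
    exec W x (CIf b c1 c2) s s' t.+1
| exec_while_stop b c s :
    eval_test x s b = Some false -> exec W x (CWhile b c) s s 1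
| exec_while_loop b c s s1 s2 t1 t2 :
    eval_test x s b = Some true ->
    exec W x c s s1 t1 -> exec W x (CWhile b c) s1 s2 t2 ->
    exec W x (CWhile b c) s s2 (t1 + t2).+1.

(** * Data structures run by the machine *)

(* what persists between two accesses: the nodes and a pointer to the root *)
Record store (k : nat) (K : Type) := Store {
  sroot : option K;
  smem : heap k K }.

(* the pointer v, coming from the node par, leads to a linked copy of t *)
Fixpoint linked (k : nat) (K : Type) (h : heap k K) (par v : option K)
    (t : tree K) : Prop :=
  if t is Node l a r then
    [/\ v = Some a, ptr h PParent a = par,
        linked h (Some a) (ptr h PLeft a) l &
        linked h (Some a) (ptr h PRight a) r]
  else v = None.

(* the store is the binary search tree t, with integer fields below W;
   the pointers [PExtra] are unconstrained *)
Definition stores (W k : nat) (d : Order.disp_t) (K : finOrderType d)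
    (s : store k K) (t : tree K) : Prop :=
  [/\ bst t, linked (smem s) None (sroot s) t &
      forall i a, fld (smem s) i a < W].

(* An access starts with the root in pointer register 0 and all other registers
   cleared; it ends with the new root in register 0 and the node of key x in
   register 1. *)
Definition ds_access (W k : nat) (d : Order.disp_t) (K : finOrderType d)
    (prog : cmd k) (s : store k K) (x : K) (s' : store k K) (t : nat) : Prop :=
  exists m' : machine k K,
    [/\ exec W x prog
          (Machine (upd (fun=> None) 0 (sroot s)) (fun=> 0) (smem s)) m' t,
        preg m' 1 = Some x &
        s' = Store (preg m' 0) (mem m')].

(* [ds_serves W prog s X ts]: starting from s, the program serves X, its i-th
   access taking ts_i steps and leaving a binary search tree on all the keys *)
Inductive ds_serves (W k : nat) (d : Order.disp_t) (K : finOrderType d)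
    (prog : cmd k) : store k K -> seq K -> seq nat -> Prop :=
| ds_serves_nil s : ds_serves W prog s [::] [::]
| ds_serves_cons s x s' t' a X ts :
    ds_access W prog s x s' a -> stores W s' t' ->
    ds_serves W prog s' X ts ->
    ds_serves W prog s (x :: X) (a :: ts).

Definition lg (n : nat) : nat := trunc_log 2 n.

(** * Existence of the minima, determinism of the machine *)

Lemma minimumP (P : nat -> Prop) :
  (exists m, P m) -> is_minimum P (minimum P).
Proof.
move=> exP; apply: epsilon_spec.
pose Q m : bool := if excluded_middle_informative (P m) then true else false.
have QP m : reflect (P m) (Q m).
  by rewrite /Q; case: excluded_middle_informative => ?; constructor.
have exQ : exists m, Q m by case: exP => m /QP; exists m.
by case: (ex_minnP exQ) => m /QP Pm minm; exists m; split=> // m' /QP /minm.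
Qed.

Lemma walk_down (K : finType) (T t : tree K) (x : K) :
  (forall p q, child t p q -> child T p q) -> x \in inorder t ->
  exists r A, root_key t = Some r /\ walk T r A T x.
Proof.
elim: t => [//|l IHl k r IHr] /= sub; rewrite mem_cat inE.
case/or3P => [xl|/eqP->|xr].
- have [||r0 [A [rt w]]] := IHl => //.
    by move=> p q cpq; apply: sub; rewrite cpq orbT.
  exists k, (k |: A); split=> //; apply: walk_move w.
  by rewrite sub // rt !eqxx.
- by exists k, [set k]; split=> //; apply: walk_stop.
- have [||r0 [A [rt w]]] := IHr => //.
    by move=> p q cpq; apply: sub; rewrite cpq !orbT.
  exists k, (k |: A); split=> //; apply: walk_move w.
  by rewrite sub // rt !eqxx !orbT.
Qed.

Lemma bst_serves_ex (d : Order.disp_t) (K : finOrderType d) (t : tree K) X :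
  bst t -> exists m, bst_serves t X m.
Proof.
move=> [_ all_t]; elim: X => [|x X [m sm]]; first by exists 0; constructor.
have [r [A [rt w]]] := walk_down (fun p q (c : child t p q) => c) (all_t x).
by exists (#|A| + m); apply: bst_serves_cons sm; exists r, A.
Qed.

Lemma bst_ex (d : Order.disp_t) (K : finOrderType d) :
  exists t : tree K, bst t.
Proof.
pose spine := foldr (fun k t => Node Leaf k t) (@Leaf K).
have spineE s : inorder (spine s) = s by elim: s => //= k s ->.
exists (spine (sort <=%O (enum K))); rewrite /bst spineE; split=> [|k].
  by rewrite sort_lt_sorted enum_uniq.
by rewrite mem_sort mem_enum.
Qed.

Lemma OPT_fromP (d : Order.disp_t) (K : finOrderType d) (t : tree K) X :
  bst t -> is_minimum (bst_serves t X) (OPT_from t X).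
Proof. by move=> bt; apply/minimumP/bst_serves_ex. Qed.

Lemma OPTP (d : Order.disp_t) (K : finOrderType d) (X : seq K) :
  is_minimum (fun m => exists2 t : tree K, bst t & bst_serves t X m) (OPT X).
Proof.
apply: minimumP; have [t bt] := bst_ex K.
by have [m sm] := bst_serves_ex X bt; exists m, t.
Qed.

Lemma exec_det (W : nat) (d : Order.disp_t) (K : finOrderType d) (x : K)
    (k : nat) (c : cmd k) s s1 s2 t1 t2 :
  exec W x c s s1 t1 -> exec W x c s s2 t2 -> s1 = s2 /\ t1 = t2.
Proof.
move=> e1; elim: e1 s2 t2 => {c s s1 t1}.
- by move=> i s s' e s2 t2 e2; inversion e2; subst; split=> //; congruence.
- move=> c1 c2 s sa sb ta tb _ IH1 _ IH2 s2 t2 e2; inversion e2; subst.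
  have [? ?] := IH1 _ _ ltac:(eassumption); subst.
  by have [? ?] := IH2 _ _ ltac:(eassumption); subst.
- move=> b c1 c2 v s s' t ev _ IH s2 t2 e2; inversion e2; subst.
  have vE : v = v0 by congruence.
  by subst; have [? ?] := IH _ _ ltac:(eassumption); subst.
- by move=> b c s ev s2 t2 e2; inversion e2; subst => //; congruence.
- move=> b c s sa sb ta tb ev _ IH1 _ IH2 s2 t2 e2; inversion e2; subst.
    by congruence.
  have [? ?] := IH1 _ _ ltac:(eassumption); subst.
  by have [? ?] := IH2 _ _ ltac:(eassumption); subst.
Qed.

(* Main.v *)
(** The left, right and parent pointers form a static balanced tree and never
    change; only the extra pointers are used to be competitive.  Four consecutive
    keys make up one node of a perfect reference tree, so that a reference node
    owns four extra pointers: to the leaf at the bottom of the preferred path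
    that starts there, to a fixed ancestor, and to the two keys that bound its
    range.

    To access x, start at the root with the bottom leaf b of its preferred path.
    The node where the path to x leaves that preferred path is the deepest
    ancestor of b whose range contains x; it is found from b in O(log log n) steps
    by jumping over ancestors, and in parallel by walking down from the start of
    the path, so that all searches of an access together cost O(log n).  Then b
    becomes the bottom stored at the abandoned child, and the search goes on from
    the other child.  Each change of a preferred child thus costs O(log log n).

    By Wilber's argument, as presented with tango trees, any search tree touches a
    transition point of a reference node between two changes of its preferred
    child, and distinct reference nodes have distinct transition points.  The
    initial tree, with all preferred children on the left, leaves no additive
    term. *)

Require Import Defs.
From mathcomp Require Import all_boot all_order zify.

Set Implicit Arguments.
Unset Strict Implicit.
Unset Printing Implicit Defensive.

Import Order.TTheory.

(** * Highest nodes and transition points *)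

Section Tops.
Variables (d : Order.disp_t) (K : finOrderType d).
Implicit Types (t l r : tree K) (x y z p q u v : K) (I J : pred K) (B : {set K}).

Definition convex I := forall x y z, I x -> I z -> (x < y)%O -> (y < z)%O -> I y.

(** A convex [I] that misses the root key of a sorted tree meets only one of the two subtrees, so
    for convex [I] this is the lowest common ancestor of its keys. *)
Fixpoint top I t : option K :=
  if t is Node l k r then
    if I k then Some k else if has I (inorder l) then top I l else top I r
  else None.

Lemma top_in I t z : top I t = Some z -> I z /\ z \in inorder t.
Proof.
elim: t => //= l IHl k r IHr; rewrite mem_cat inE.
case: ifP => [Ik [<-]|_]; first by rewrite eqxx orbT.
by case: ifP => _ => [/IHl|/IHr] [-> ->]; rewrite ?orbT.
Qed.

Lemma top_ex I t : has I (inorder t) -> exists z, top I t = Some z.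
Proof.
elim: t => //= l IHl k r IHr; rewrite has_cat /=.
case: ifP => [_ _|_]; first by exists k.
by case: ifP => [/IHl //|_ /= /IHr].
Qed.

(** The descent for [I] follows the one for [J]: a root outside [J] is outside [I], and [z] is a key
    of [I] in the subtree chosen for [J]. *)
Lemma top_sub I J t z :
  (forall x, I x -> J x) -> top J t = Some z -> I z -> top I t = Some z.
Proof.
move=> IJ; elim: t => //= l IHl k r IHr.
case: ifP => [_ [->] -> //|Jk]; have -> : I k = false by apply/negP => /IJ; rewrite Jk.
case: ifP => [_ tl Iz|/negbT hJ tr Iz].
  by rewrite ifT; [apply: IHl | apply/hasP; exists z => //; have [] := top_in tl].
rewrite ifF; first exact: IHr.
by apply: contraNF hJ; apply: sub_has.
Qed.

Lemma sorted_node l k r : sorted <%O (inorder (Node l k r)) ->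
  [/\ sorted <%O (inorder l), sorted <%O (inorder r),
      forall x, x \in inorder l -> (x < k)%O &
      forall x, x \in inorder r -> (k < x)%O].
Proof.
rewrite /= -cat1s; rewrite !lt_sorted_pairwise pairwise_cat /= => /and3P[].
rewrite allrel_consr => /andP[/allP al _] pl /andP[/allP ar pr].
by rewrite pl pr.
Qed.

(* A walk from the root keeps the set of touched nodes closed. *)
Definition closed B t := forall u v, child t u v -> v \in B -> u \in B.

Lemma root_key_mem t z : root_key t == Some z -> z \in inorder t.
Proof. by case: t => //= ? ? ? /eqP[->]; rewrite mem_cat inE eqxx orbT. Qed.

Lemma child_mem t p q : child t p q -> p \in inorder t /\ q \in inorder t.
Proof.
elim: t => //= l IHl k r IHr; rewrite !mem_cat !inE.
case/or3P => [/andP[/eqP-> /orP[] /root_key_mem ->]|/IHl[-> ->]|/IHr[-> ->]];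
by rewrite ?eqxx ?orbT.
Qed.

Lemma child_root t p q : sorted <%O (inorder t) -> child t p q ->
  root_key t <> Some q.
Proof.
case: t => //= l k r /sorted_node[_ _ hl hr] c [E]; subst q.
case/or3P: c => [/andP[_ /orP[] /root_key_mem]|/child_mem[_]|/child_mem[_]].
all: by move=> /hl + || move=> /hr; rewrite ltxx.
Qed.

Lemma child_uniq t u p q : sorted <%O (inorder t) ->
  child t u q -> child t p q -> u = p.
Proof.
elim: t => //= l IHl k r IHr so; have [sl sr hl hr] := sorted_node so.
have no_both z : z \in inorder l -> z \in inorder r -> False.
  by move=> /hl a /hr b; have := lt_trans a b; rewrite ltxx.
case/or3P => [/andP[/eqP<- rq]|cu|cu] /or3P[/andP[/eqP<- rq']|cp|cp] //.
- case/orP: rq => rq; first by case: (child_root sl cp); apply/eqP.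
  by case: (no_both q); [case: (child_mem cp)|apply: root_key_mem].
- case/orP: rq => rq; last by case: (child_root sr cp); apply/eqP.
  by case: (no_both q); [apply: root_key_mem|case: (child_mem cp)].
- case/orP: rq' => rq; first by case: (child_root sl cu); apply/eqP.
  by case: (no_both q); [case: (child_mem cu)|apply: root_key_mem].
- exact: IHl.
- by case: (no_both q); [case: (child_mem cu)|case: (child_mem cp)].
- case/orP: rq' => rq; last by case: (child_root sr cu); apply/eqP.
  by case: (no_both q); [apply: root_key_mem|case: (child_mem cu)].
- by case: (no_both q); [case: (child_mem cp)|case: (child_mem cu)].
- exact: IHr.
Qed.

Lemma closed_node B l k r : closed B (Node l k r) -> closed B l /\ closed B r.
Proof.
move=> c; split=> u v cuv; apply: c; first by rewrite /= cuv orbT.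
by rewrite /= cuv !orbT.
Qed.

Lemma closed_root B t k x : root_key t = Some k -> closed B t ->
  x \in inorder t -> x \in B -> k \in B.
Proof.
elim: t k => // l IHl k r IHr _ [<-] c; have [cl cr] := closed_node c.
rewrite /= mem_cat inE => /or3P[xl|/eqP-> //|xr] xB.
- case El: (root_key l) => [k1|]; last by case: (l) El xl.
  by apply: c (IHl _ El cl xl xB); rewrite /= El !eqxx.
- case Er: (root_key r) => [k1|]; last by case: (r) Er xr.
  by apply: c (IHr _ Er cr xr xB); rewrite /= Er !eqxx !orbT.
Qed.

(** The highest node of a convex [I] is an ancestor of every key of [I], so a parent-closed set that
    meets [I] contains it. *)
Lemma closed_top B I t x z : sorted <%O (inorder t) -> convex I -> closed B t ->
  x \in inorder t -> x \in B -> I x -> top I t = Some z -> z \in B.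
Proof.
move=> so cv; elim: t so => // l IHl k r IHr so cl xt xB Ix /=.
have [sl sr hl hr] := sorted_node so; have [cll clr] := closed_node cl.
case: ifP => [_ [<-]|Ik]; first exact: (@closed_root B (Node l k r) k x erefl cl xt xB).
move: xt; rewrite /= mem_cat inE => /or3P[xl|/eqP E|xr].
- by rewrite ifT; [exact: IHl | apply/hasP; exists x].
- by rewrite E Ik in Ix.
- rewrite ifF; first exact: IHr.
  apply/negP => /hasP[y yl Iy]; move/negP: Ik; apply.
  exact: cv Iy Ix (hl _ yl) (hr _ xr).
Qed.

Lemma rotation_inorder t p t1 : rotation t p t1 -> inorder t1 = inorder t.
Proof.
elim=> {t p t1} /= [a x b y c|a y b x c|l l' k r x _ ->|l k r r' x _ ->] //.
all: by rewrite -catA.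
Qed.

Lemma rotation_mem t p t1 : rotation t p t1 -> p \in inorder t.
Proof.
by elim=> {t p t1} /= [a x b y c|a y b x c|l l' k r x _ h|l k r r' x _ h];
  rewrite !(mem_cat, inE) ?eqxx ?h ?orbT.
Qed.

Lemma rotation_closed B t p t1 :
  rotation t p t1 -> closed B t -> p \in B -> closed B t1.
Proof.
elim=> {t p t1} [a x b y c|a y b x c|l l' k r x ro IH|l k r r' x ro IH] cl xB.
- have yB : y \in B by apply: (cl y x) xB; rewrite /= !eqxx.
  have [/closed_node[ca cb] cc] := closed_node cl.
  move=> u v /= /or3P[/andP[/eqP<- //]|/ca|/or3P[/andP[/eqP<- //]|/cb|/cc]]; exact.
- have yB : y \in B by apply: (cl y x) xB; rewrite /= !eqxx !orbT.
  have [ca /closed_node[cb cc]] := closed_node cl.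
  move=> u v /= /or3P[/andP[/eqP<- //]|/or3P[/andP[/eqP<- //]|/ca|/cb]|/cc]; exact.
- have kB : k \in B.
    apply: (@closed_root B (Node l k r) k x erefl cl _ xB).
    by rewrite /= mem_cat (rotation_mem ro).
  have [ca cb] := closed_node cl; move=> u v /= /or3P[/andP[/eqP<- //]| |/cb];
    [exact: IH | exact].
- have kB : k \in B.
    apply: (@closed_root B (Node l k r) k x erefl cl _ xB).
    by rewrite /= mem_cat inE (rotation_mem ro) !orbT.
  have [ca cb] := closed_node cl; move=> u v /= /or3P[/andP[/eqP<- //]|/ca|];
    [exact | exact: IH].
Qed.

(** A rotation only exchanges the order of [p] and its parent [g] on root paths, so a highest node
    can change only within this pair. *)
Lemma rotation_top t p t1 : sorted <%O (inorder t) -> rotation t p t1 ->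
  exists2 g, child t g p & forall I, convex I -> top I t1 = top I t \/
    exists z z', [/\ top I t = Some z, top I t1 = Some z',
                     z \in [:: p; g] & z' \in [:: p; g]].
Proof.
move=> so ro; elim: ro so => {t p t1}
  [a x b y c|a y b x c|l l' k r x ro IH|l k r r' x ro IH] so.
- exists y; first by rewrite /= !eqxx.
  have [so' _ hl hr] := sorted_node so; have [_ _ ha hb] := sorted_node so'.
  have xy : (x < y)%O by apply: hl; rewrite /= mem_cat inE eqxx orbT.
  move=> I cv /=; rewrite !has_cat /=.
  have [Ix|Ix] := boolP (I x); have [Iy|Iy] := boolP (I y); rewrite /= ?orbT.
  + by right; exists y, x; rewrite !inE !eqxx orbT.
  + by left.
  + right; exists y, y; rewrite !inE eqxx orbT; split=> //.
    rewrite ifF //; apply/negP => /hasP[w wa Iw]; move/negP: Ix; apply.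
    exact: cv Iw Iy (ha _ wa) xy.
  + by left; case: ifP => //=.
- exists y; first by rewrite /= !eqxx !orbT.
  have [_ so' hl hr] := sorted_node so; have [_ _ ha hb] := sorted_node so'.
  have xy : (y < x)%O by apply: hr; rewrite /= mem_cat inE eqxx orbT.
  move=> I cv /=; rewrite !has_cat /=.
  have [Ix|Ix] := boolP (I x); have [Iy|Iy] := boolP (I y); rewrite /= ?orbT.
  + by right; exists y, x; rewrite !inE !eqxx orbT.
  + right; exists x, x; rewrite !inE eqxx; split=> //.
    rewrite ifF //; apply/negP => /hasP[w wa Iw]; move/negP: Iy; apply.
    exact: cv Iw Ix (hl _ wa) xy.
  + by right; exists y, y; rewrite !inE eqxx orbT.
  + by left; case: (has I (inorder a)).
- have [sl _ _ _] := sorted_node so; have [g cg H] := IH sl.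
  exists g; first by rewrite /= cg orbT.
  move=> I cv /=; rewrite (rotation_inorder ro).
  by case: ifP => _; [left | case: ifP => _; [exact: H | left]].
- have [_ sr _ _] := sorted_node so; have [g cg H] := IH sr.
  exists g; first by rewrite /= cg !orbT.
  move=> I cv /=.
  by case: ifP => _; [left | case: ifP => _; [left | exact: H]].
Qed.

End Tops.

(** * Regions with two sides, and their transition points during a walk *)

Section Transition.
Variables (d : Order.disp_t) (K : finOrderType d).
Implicit Types (t : tree K) (x y z p q : K) (A B : {set K}).

Record region := Region { whole : pred K; rightp : pred K }.

Definition leftp (g : region) : pred K := fun x => whole g x && ~~ rightp g x.

Definition side (g : region) (b : bool) : pred K := if b then rightp g else leftp g.

Definition proper_region (g : region) :=
  [/\ forall x, rightp g x -> whole g x, convex (whole g),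
      forall b, convex (side g b) & forall b, exists x, side g b x].

(* the side whose highest node is not the highest node of the whole region *)
Definition low_side (g : region) t : bool :=
  if top (whole g) t is Some w then ~~ rightp g w else false.

(** Wilber's transition point, as the deeper of the lowest common ancestors of the two sides. *)
Definition transition (g : region) t := top (side g (low_side g t)) t.

Variable g : region.
Hypothesis gP : proper_region g.

Lemma side_whole b x : side g b x -> whole g x.
Proof. by case: gP => R _ _ _; case: b => /= [/R|/andP[]]. Qed.

Lemma side_disjoint b x : side g b x -> side g (~~ b) x = false.
Proof.
by case: b; rewrite /= /leftp; [move=> ->; rewrite andbF | case/andP=> _ /negbTE].
Qed.

Lemma whole_side x : whole g x -> side g (rightp g x) x.
Proof. by rewrite /side /leftp; case: ifP => // -> ->. Qed.

Lemma transition_ex t : bst t -> exists z,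
  [/\ transition g t = Some z, side g (low_side g t) z &
      top (whole g) t <> Some z].
Proof.
move=> [_ tall]; have exb b : has (side g b) (inorder t).
  by case: gP => _ _ _ /(_ b)[x sx]; apply/hasP; exists x.
have [z tz] := top_ex (exb (low_side g t)); exists z.
have [sz zt] := top_in tz; split=> // tw; move: sz.
rewrite /low_side tw; have [wz _] := top_in tw.
by rewrite (side_disjoint (whole_side wz)).
Qed.

(** Only a rotation that involves the transition point itself can move it or exchange the roles of
    the two sides. *)
Lemma transition_rotation t p t1 : sorted <%O (inorder t) -> rotation t p t1 ->
  exists2 h, child t h p & forall z, transition g t = Some z ->
    side g (low_side g t) z -> (exists w, top (whole g) t = Some w) ->
    z \notin [:: p; h] ->
    transition g t1 = Some z /\ low_side g t1 = low_side g t.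
Proof.
move=> so ro; have [h ch H] := rotation_top so ro; exists h => // z tz sz [w tw] zn.
have [_ cW cS _] := gP.
have tz1 : top (side g (low_side g t)) t1 = Some z.
  have [-> //|[z1 [z2 [e1 _ m1 _]]]] := H _ (cS (low_side g t)).
  by move: e1 zn; rewrite -/(transition g t) tz => -[->]; rewrite m1.
suff E : low_side g t1 = low_side g t by rewrite /transition E.
have [e|[w1 [w2 [_ e2 _ m2]]]] := H _ cW; first by rewrite /low_side e.
have [ww2 _] := top_in e2; rewrite {1}/low_side e2.
have [E|] := eqVneq (rightp g w2) (low_side g t); last first.
  by case: (rightp _ _); case: (low_side _ _).
(* If the new highest node [w2] lay on the low side, it would be highest there too, hence equal to
   [z], which is not one of the two rotated nodes. *)
have sw : side g (low_side g t) w2 by rewrite -E whole_side.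
move: tz1; rewrite (top_sub (@side_whole _) e2 sw) => -[E2].
by move: zn; rewrite -E2 m2.
Qed.

Lemma top_whole_ex t : bst t -> exists w, top (whole g) t = Some w.
Proof.
move=> [_ tall]; apply: top_ex; apply/hasP.
by case: gP => R _ _ /(_ true)[x /R wx]; exists x.
Qed.

Lemma bst_rotation t p t1 : bst t -> rotation t p t1 -> bst t1.
Proof. by move=> [so al] ro; split=> [|k]; rewrite (rotation_inorder ro). Qed.

(** The set [B] collects the nodes touched before. Being closed under parents, it contains the
    parent in every rotation, so an untouched transition point takes part in none. *)
Lemma walk_transition t p A t' x : walk t p A t' x ->
  forall B, bst t -> closed B t -> p \in B ->
  [/\ bst t', closed (B :|: A) t', p \in A, x \in A &
   forall z, transition g t = Some z -> z \notin B :|: A ->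
     transition g t' = Some z /\ low_side g t' = low_side g t].
Proof.
elim=> {t p A t' x} [t p|t p q A t' z ch _ IH|t p t1 A t' z ro _ IH] B bt cB pB.
- split=> //; rewrite ?set11 //.
  by rewrite setUC (setUidPr _) // sub1set.
- have [so _] := bt.
  (* On a move down the parent of [q] is [p]; on a move up [q] is already in [B]. *)
  have cqB : closed (q |: B) t.
    move=> u v cuv; rewrite !inE => /orP[/eqP E|vB]; last by rewrite (cB _ _ cuv vB) orbT.
    subst v; case/orP: ch => ch; first by rewrite (child_uniq so cuv ch) pB orbT.
    by rewrite (cB _ _ cuv (cB _ _ ch pB)) orbT.
  have [|bt' cA qA zA H] := IH (q |: B) bt cqB; first by rewrite !inE eqxx.
  have E : (q |: B) :|: A = B :|: (p |: A).
    apply/setP=> w; rewrite !inE; case: (eqVneq w q) => [->|_]; first by rewrite qA !orbT.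
    by case: (eqVneq w p) => [->|_]; rewrite ?pB ?orbT.
  by rewrite E in cA H; rewrite !inE eqxx zA orbT; split.
- have [so _] := bt; have cB1 := rotation_closed ro cB pB.
  have [bt' cA pA zA H] := IH B (bst_rotation bt ro) cB1 pB.
  split=> // w tw wn; have [h ch Hh] := transition_rotation so ro.
  have [w0 [tw0 sw0 _]] := transition_ex bt; move: tw0 sw0; rewrite tw => -[<-] sw.
  have [|e1 e2] := Hh w tw sw (top_whole_ex bt).
    rewrite !inE negb_or; have hB := cB _ _ ch pB.
    by apply/andP; split; apply: contraNneq wn => ->; rewrite inE ?pB ?hB.
  by rewrite -e2; apply: H.
Qed.

End Transition.

(** * Transition points during one access *)

Section Access.
Variables (d : Order.disp_t) (K : finOrderType d).
Implicit Types (t : tree K) (x z : K) (g : region K).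

(** If [z] stays untouched it is still the highest node of the low side in [t']. Were [x] on that
    side, [z] would be an ancestor of the touched node [x] in [t'], and so touched as well. *)
Lemma bst_access_transition t x t' m : bst t -> bst_access t x t' m ->
  exists A : {set K}, [/\ m = #|A|, bst t', x \in A &
   forall g, proper_region g -> forall z, transition g t = Some z ->
     (side g (low_side g t) x -> z \in A) /\
     (z \notin A -> low_side g t' = low_side g t)].
Proof.
move=> bt [r [A [rt w ->]]]; exists A; have [so _] := bt.
have c0 : closed [set r] t.
  by move=> u v cuv; rewrite inE => /eqP E; case: (child_root so cuv); rewrite rt E.
have rA p B s : walk t p B t' s -> p \in B.
  elim=> {t p B t' s bt rt w so c0} [t p|t p q B t' s _ _ _|t p t1 B t' s _ _ //];
    by rewrite !inE ?eqxx.
have UA : [set r] :|: A = A by apply/setUidPr; rewrite sub1set (rA _ _ _ w).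
have xA : x \in A.
  by elim: w {rt c0 rA UA} => // *; rewrite !inE ?eqxx // orbC; apply/orP; left.
have bt' : bst t'.
  elim: w bt {rt c0 rA UA xA so} => // s p s1 B s' z ro _ IH bs.
  exact/IH/bst_rotation/ro.
split=> // g gP z tz.
have [_ cA _ _] := walk_transition gP w bt c0 (set11 r); rewrite UA => H.
have H2 : z \notin A -> low_side g t' = low_side g t by move=> zA; case: (H z tz zA).
split=> // sx; apply: contraT => zA; have [tz' E] := H z tz zA.
have [so' al'] := bt'; have [_ _ cS _] := gP; rewrite UA in cA.
have := closed_top so' (cS (low_side g t)) cA (al' x) xA sx.
by move=> /(_ z); rewrite -E -/(transition g t') tz' (negbTE zA) => ->.
Qed.

Definition nested g1 g2 := exists b, forall x, whole g2 x -> side g1 b x.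

Definition apart g1 g2 := forall x, whole g1 x -> whole g2 x -> False.

(** A common [z] would be highest in the side of [g1] that contains [g2], hence highest in all of
    [g2], where the transition point never is. *)
Lemma transition_nested t g1 g2 z : bst t -> proper_region g1 -> proper_region g2 ->
  nested g1 g2 -> transition g1 t = Some z -> transition g2 t = Some z -> False.
Proof.
move=> bt P1 P2 [b sub] t1 t2.
have [z1 [e1 s1 _]] := transition_ex P1 bt; move: e1 s1; rewrite t1 => -[<-] s1.
have [z2 [e2 s2 n2]] := transition_ex P2 bt; move: e2 s2 n2; rewrite t2 => -[<-] s2 n2.
have w2 := side_whole P2 s2; have sb := sub _ w2.
have E : b = low_side g1 t.
  have [//|bn] := eqVneq b (low_side g1 t).
  have E : ~~ b = low_side g1 t by move: bn; case: (b); case: (low_side _ _).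
  by move: s1; rewrite -E side_disjoint.
by apply: n2; apply: top_sub (t1) w2; rewrite -E.
Qed.

Lemma transition_apart t g1 g2 z : bst t -> proper_region g1 -> proper_region g2 ->
  apart g1 g2 -> transition g1 t = Some z -> transition g2 t = Some z -> False.
Proof.
move=> bt P1 P2 ap t1 t2; have wz g : proper_region g ->
    transition g t = Some z -> whole g z.
  move=> gP tz; have [z1 [e1 + _]] := transition_ex gP bt.
  by move: e1; rewrite tz => -[<-]; apply: side_whole.
by apply: (ap z); apply: wz.
Qed.

End Access.

(** * The reference tree *)

Section Prefix.
Implicit Types (p q a b : seq bool) (c : bool).

Lemma prefix_size p q : prefix p q -> size p <= size q.
Proof. by case/prefixP=> s ->; rewrite size_cat leq_addr. Qed.

Lemma prefix_eq p q : prefix p q -> size q <= size p -> p = q.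
Proof.
by case/prefixP=> s ->; rewrite size_cat -{2}[size p]addn0 leq_add2l leqn0 size_eq0
  => /eqP->; rewrite cats0.
Qed.

Lemma prefix_rconsl p c q : prefix (rcons p c) q -> prefix p q.
Proof. by apply: prefix_trans; rewrite prefix_rcons. Qed.

Lemma prefix_total p q a : prefix p a -> prefix q a -> size p <= size q -> prefix p q.
Proof.
rewrite !prefixE => /eqP pa /eqP qa le; by rewrite -qa take_takel // pa.
Qed.

Lemma prefix_strict p q : prefix p q -> size p < size q ->
  exists c, prefix (rcons p c) q.
Proof.
case/prefixP=> -[|c s] ->; first by rewrite cats0 ltnn.
by exists c; rewrite -cat_rcons prefix_prefix.
Qed.

Lemma prefix_rcons2 p c c' q :
  prefix (rcons p c) q -> prefix (rcons p c') q -> c = c'.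
Proof.
move=> h1 h2; have := prefix_total h1 h2; rewrite !size_rcons => /(_ (leqnn _)) h.
have := prefix_eq h; rewrite !size_rcons => /(_ (leqnn _)) /rcons_inj[] //.
Qed.

Lemma prefix_rcons_neg p c q : prefix p q -> size p < size q ->
  ~~ prefix (rcons p c) q = prefix (rcons p (~~ c)) q.
Proof.
move=> pq lt; have [c' h] := prefix_strict pq lt.
apply/idP/idP => [n|h1]; last by apply/negP => /(prefix_rcons2 h1); case: (c).
by have -> : ~~ c = c' by move: n h; case: (c) (c') => -[] // /negbTE ->.
Qed.

End Prefix.

Section Reference.
Variables (d : Order.disp_t) (K : finOrderType d).
Implicit Types (x : K) (p : seq bool) (s : seq K).

(* A reference node holds four consecutive keys, which share its four pointers. *)
Inductive qtree :=
| Cell of seq K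
| Quad of qtree & K & K & K & K & qtree.

Definition spine s : tree K := foldr (fun k t => Node Leaf k t) Leaf s.

(** One reference edge amounts to two edges of this tree: from [b] to [a] or [e], and on to the next
    group. *)
Fixpoint phys (q : qtree) : tree K :=
  match q with
  | Cell s => spine s
  | Quad l a b c e r =>
      Node (Node (phys l) a Leaf) b (Node (Node Leaf c Leaf) e (phys r))
  end.

Fixpoint keys (q : qtree) : seq K :=
  match q with
  | Cell s => s
  | Quad l a b c e r => keys l ++ [:: a, b, c, e & keys r]
  end.

Fixpoint perfect (n : nat) (q : qtree) : bool :=
  match n, q with
  | 0, Cell s => size s <= 5
  | n'.+1, Quad l _ _ _ _ r => perfect n' l && perfect n' r
  | _, _ => false
  end.

Fixpoint qsub (q : qtree) p {struct p} : qtree :=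
  match p, q with
  | c :: p', Quad l _ _ _ _ r => qsub (if c then r else l) p'
  | _, _ => q
  end.

Fixpoint build (n : nat) s : qtree :=
  if n is n'.+1 then
    let i := (size s - 4)./2 in
    if drop i s is [:: a, b, c, e & r]
    then Quad (build n' (take i s)) a b c e (build n' r) else Cell s
  else Cell s.

Lemma inorder_phys q : inorder (phys q) = keys q.
Proof.
elim: q => /= [s|l -> a b c e r ->]; last by rewrite -catA.
by elim: s => //= k s ->.
Qed.

Lemma keys_build n s : keys (build n s) = s.
Proof.
elim: n s => //= n IH s.
case E: (drop _ s) => [|a [|b [|c [|e r]]]] //=.
by rewrite !IH -E cat_take_drop.
Qed.

(** Taking away four keys and halving the rest turns these bounds for [n.+1] into those for [n]; at
    [n = 0] the upper one is 5, the capacity of a cell. *)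
Lemma perfect_build n s :
  4 * (2 ^ n - 1) <= size s <= 8 * 2 ^ n - 3 -> perfect n (build n s).
Proof.
elim: n s => [|n IH] s /=; first by rewrite expn0 /=; lia.
have := expn_gt0 2 n; rewrite expnS; move: (2 ^ n) IH => m IH m0 /andP[le1 le2].
set i := _./2; have szi : size (take i s) = i by rewrite size_takel // /i; lia.
have szd : size (drop i s) = size s - i by rewrite size_drop.
case E: (drop i s) szd => [|a [|b [|c [|e r]]]] /= szd; try by rewrite /i in szd *; lia.
by rewrite !IH // ?szi /i; rewrite /i in szd; lia.
Qed.

Lemma qsub_rcons q p c : qsub q (rcons p c) = qsub (qsub q p) [:: c].
Proof. by elim: p q => [//|c' p IH] [s|l a b e f r] //=; rewrite IH. Qed.

Lemma perfect_qsub n q p :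
  perfect n q -> size p <= n -> perfect (n - size p) (qsub q p).
Proof.
elim: p n q => [|c p IH] [|n] [s|l a b e f r] //= /andP[pl pr] le.
by rewrite subSS; apply: IH => //; case: (c).
Qed.

Lemma keys_qsub q p : {subset keys (qsub q p) <= keys q}.
Proof.
elim: p q => [|c p IH] [s|l a b e f r] //= x /IH.
by rewrite mem_cat !inE; case: (c) => ->; rewrite ?orbT.
Qed.

Lemma sorted_quad l a b c e r : sorted <%O (keys (Quad l a b c e r)) ->
  [/\ sorted <%O (keys l), sorted <%O (keys r),
      forall x, x \in keys l -> (x < a)%O,
      forall x, x \in keys r -> (e < x)%O &
      [/\ (a < b)%O, (b < c)%O & (c < e)%O]].
Proof.
rewrite /= !lt_sorted_pairwise pairwise_cat allrel_consr /=.
case/andP=> /andP[/allP al _] /andP[pl].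
case/andP=> /andP[ab _] /andP[/andP[bc _] /andP[/andP[ce _] /andP[/allP er pr]]].
by split.
Qed.

Lemma sorted_qsub q p : sorted <%O (keys q) -> sorted <%O (keys (qsub q p)).
Proof.
elim: p q => [|c p IH] [s|l a b e f r] // so /=.
by have [sl sr _ _ _] := sorted_quad so; apply: IH; case: (c).
Qed.

(* Truncated at depth n: the keys of a cell get the address of the leaf above it. *)
Fixpoint addr (n : nat) (q : qtree) x : seq bool :=
  if n is n'.+1 then
    if q is Quad l a _ _ e r then
      if (x < a)%O then false :: addr n' l x
      else if (e < x)%O then true :: addr n' r x else [::]
    else [::]
  else [::].

Lemma size_addr n q x : size (addr n q x) <= n.
Proof.
elim: n q => //= n IH [s|l a b e f r] //.
by case: ifP => _ /=; [apply: IH | case: ifP => _ //=; apply: IH].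
Qed.

(** Cells lie at depth [n.+1], one below the truncation, so every [p] of length at most [n] leads to
    a [Quad] and truncation does not affect the comparison with [p]. *)
Lemma prefix_addr n q x p : perfect n.+1 q -> sorted <%O (keys q) ->
  x \in keys q -> size p <= n -> prefix p (addr n q x) = (x \in keys (qsub q p)).
Proof.
elim: n q p => [|n IH] q [|c p] //; try by move=> _ _ xq _; rewrite prefix0s.
case: q => [//|l a b e f r] /andP[pl pr] so xq lt.
have [sl sr hl hr [ab bc ce]] := sorted_quad so; rewrite [addr _ _ _]/=.
have af := lt_trans (lt_trans ab bc) ce.
case: (boolP (x < a)%O) => xa.
  have xl : x \in keys l.
    move: xq; rewrite /= mem_cat => /orP[//|xq]; suff : (x < x)%O by rewrite ltxx.
    apply: lt_le_trans xa _; move: xq; rewrite !inE.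
    case/or4P => [/eqP->//|/eqP->|/eqP->|/orP[/eqP->|/hr xr]].
    - exact: ltW. - by rewrite ltW // (lt_trans ab). - exact: ltW.
    - by rewrite ltW // (lt_trans af).
  case: (c) => /=; last exact: IH.
  apply/esym/negP => /keys_qsub /hr; rewrite ltNge => /negP; apply.
  exact/ltW/(lt_trans xa).
case: (boolP (f < x)%O) => fx.
  have xr : x \in keys r.
    move: xq; rewrite /= mem_cat => /orP[/hl xl|]; first by rewrite xl in xa.
    rewrite !inE => /or4P[/eqP xE|/eqP xE|/eqP xE|/orP[/eqP xE|//]]; subst x.
    - by have := lt_trans af fx; rewrite ltxx.
    - by have := lt_trans (lt_trans bc ce) fx; rewrite ltxx.
    - by have := lt_trans ce fx; rewrite ltxx.
    - by rewrite ltxx in fx.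
  case: (c) => /=; first exact: IH.
  apply/esym/negP => /keys_qsub /hl; rewrite ltNge => /negP; apply.
  exact/ltW/(lt_trans af).
rewrite prefixs0 /=; apply/esym/negP => /keys_qsub; case: (c) => [/hr|/hl] h.
- by rewrite h in fx.
- by rewrite h in xa.
Qed.

Fixpoint depth_in (t : tree K) x : nat :=
  if t is Node l k r then
    if x == k then 0 else if (x < k)%O then (depth_in l x).+1
    else (depth_in r x).+1
  else 0.

Lemma depth_spine s x : depth_in (spine s) x <= size s.
Proof. by elim: s => //= k s IH; case: ifP => // _; case: ifP. Qed.

End Reference.

(** * Addresses, ranges and regions of the reference nodes *)

Section Layout.
Variables (d : Order.disp_t) (K : finOrderType d).
Variables (h : nat) (Q : qtree K) (x0 : K).
Hypothesis Qperf : perfect h.+1 Q.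
Hypothesis Qsort : sorted <%O (keys Q).
Hypothesis Qall : forall x, x \in keys Q.
Implicit Types (x : K) (p q : seq bool) (c : bool).

Definition kA p := if qsub Q p is Quad _ a _ _ _ _ then a else x0.
Definition kB p := if qsub Q p is Quad _ _ b _ _ _ then b else x0.
Definition kC p := if qsub Q p is Quad _ _ _ c _ _ then c else x0.
Definition kD p := if qsub Q p is Quad _ _ _ _ e _ then e else x0.
Definition adr x := addr h Q x.

(** Addresses are reversed so that the deepest turn comes first: the last turn to the right sets the
    lower bound of a range, the last turn to the left the upper one. *)
Fixpoint lo_rev p : option K :=
  if p is c :: p' then if c then Some (kD (rev p')) else lo_rev p' else None.
Fixpoint hi_rev p : option K :=
  if p is c :: p' then if c then hi_rev p' else Some (kA (rev p')) else None.
Definition lo p := lo_rev (rev p).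
Definition hi p := hi_rev (rev p).

Definition above (o : option K) x := if o is Some y then (y < x)%O else true.
Definition below (o : option K) x := if o is Some y then (x < y)%O else true.

Lemma qsubE p : size p <= h -> qsub Q p =
  Quad (qsub Q (rcons p false)) (kA p) (kB p) (kC p) (kD p) (qsub Q (rcons p true)).
Proof.
move=> le; rewrite !qsub_rcons /kA /kB /kC /kD.
have := perfect_qsub Qperf (leqW le); rewrite subSn //.
by case: (qsub Q p).
Qed.

Lemma quad_lt p : size p <= h ->
  [/\ (kA p < kB p)%O, (kB p < kC p)%O & (kC p < kD p)%O].
Proof.
by move=> le; have := sorted_qsub p Qsort; rewrite qsubE // => /sorted_quad[].
Qed.

Lemma size_adr x : size (adr x) <= h.
Proof. exact: size_addr. Qed.

Lemma prefix_adr x p : size p <= h -> prefix p (adr x) = (x \in keys (qsub Q p)).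
Proof. by move=> le; apply: prefix_addr. Qed.

(** This lets key comparisons made by the program decide questions about addresses. *)
Lemma prefix_adr_rcons x p c : size p < h -> prefix p (adr x) ->
  prefix (rcons p c) (adr x) = if c then (kD p < x)%O else (x < kA p)%O.
Proof.
move=> lt; rewrite !prefix_adr ?size_rcons ?(ltnW lt) // (qsubE (ltnW lt)) => xp.
have := sorted_qsub p Qsort; rewrite (qsubE (ltnW lt)) => so.
have [sl sr hl hr [ab bc ce]] := sorted_quad so.
move: xp; rewrite /= mem_cat !inE.
have np y z : (y < z)%O -> (z < y)%O = false.
  by move=> yz; apply/negP => /(lt_trans yz); rewrite ltxx.
have ac := lt_trans ab bc; have be := lt_trans bc ce; have ae := lt_trans ab be.
case: c => /=.
- have hn : (x \in keys (qsub Q (rcons p false))) -> (kD p < x)%O = false.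
    by move=> /hl xa; apply: np; apply: lt_trans ae.
  case xr : (x \in keys (qsub Q (rcons p true))); first by rewrite hr.
  case/or4P => [/hn->//|/eqP->|/eqP->|]; [by rewrite np|by rewrite np|].
  by case/or3P => [/eqP->|/eqP->|//]; [rewrite np | rewrite ltxx].
- case xl : (x \in keys (qsub Q (rcons p false))); first by rewrite hl.
  case/or4P => [//|/eqP->|/eqP->|]; [by rewrite ltxx|by rewrite np|].
  case/or3P => [/eqP->|/eqP->|/hr xr]; [by rewrite np|by rewrite np|].
  by rewrite np //; apply: lt_trans xr.
Qed.

Lemma mem_quad p : size p <= h -> [/\ prefix p (adr (kA p)), prefix p (adr (kB p)),
  prefix p (adr (kC p)) & prefix p (adr (kD p))].
Proof.
by move=> le; rewrite !prefix_adr // (qsubE le) /= !mem_cat !inE !eqxx !orbT.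
Qed.

Lemma adr_between x p : size p <= h -> prefix p (adr x) ->
  (kA p <= x)%O -> (x <= kD p)%O -> adr x = p.
Proof.
move=> le px ax xe; apply/esym; apply: (prefix_eq px); rewrite leqNgt; apply/negP => lt.
have [c] := prefix_strict px lt; have lth := leq_trans lt (size_adr x).
by rewrite prefix_adr_rcons //; case: c; rewrite ltNge ?ax ?xe.
Qed.

Lemma adr_quad p : size p <= h ->
  [/\ adr (kA p) = p, adr (kB p) = p, adr (kC p) = p & adr (kD p) = p].
Proof.
move=> le; have [pa pb pc pe] := mem_quad le; have [ab bc ce] := quad_lt le.
have ac := lt_trans ab bc; have be := lt_trans bc ce; have ae := lt_trans ab be.
by split; apply: adr_between => //; apply: ltW.
Qed.

Lemma lo_rcons p c : lo (rcons p c) = if c then Some (kD p) else lo p.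
Proof. by rewrite /lo rev_rcons /= revK. Qed.

Lemma hi_rcons p c : hi (rcons p c) = if c then hi p else Some (kA p).
Proof. by rewrite /hi rev_rcons /= revK. Qed.

(** Two comparisons thus decide whether a range contains [x], without a walk from the root. *)
Lemma prefix_bounds x p : size p <= h ->
  prefix p (adr x) = above (lo p) x && below (hi p) x.
Proof.
elim/last_ind: p x => [|p c IH] x; first by rewrite prefix0s.
rewrite size_rcons => lt; rewrite lo_rcons hi_rcons.
have [pa _ _ pe] := mem_quad (ltnW lt).
have [px|npx] := boolP (prefix p (adr x)).
  rewrite prefix_adr_rcons //; move: px; rewrite IH ?(ltnW lt) // => /andP[a b].
  by case: (c); rewrite ?a ?b ?andbT.
(* A key within the bounds of the child is within those of [p]: one bound is inherited, the other is
   [kA p] or [kD p], which itself lies in the range of [p]. *)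
rewrite (contraNF (@prefix_rconsl p c (adr x)) npx); apply/esym/negP => ab.
move/negP: npx; apply; rewrite IH ?(ltnW lt) //.
move: pa pe; rewrite !IH ?(ltnW lt) // => /andP[aA bA] /andP[aD bD].
case: (c) ab => /= /andP[].
- move=> ex ->; rewrite andbT; move: aD; rewrite /above.
  by case: (lo p) => // y /lt_trans; apply.
- move=> -> ax /=; move: bA; rewrite /below.
  by case: (hi p) => // y; apply: lt_trans.
Qed.

Lemma convex_prefix p : size p <= h -> convex (fun x => prefix p (adr x)).
Proof.
move=> le x y z; rewrite !prefix_bounds // => /andP[ax _] /andP[_ bz] xy yz.
apply/andP; split.
- by move: ax; rewrite /above; case: (lo p) => // w /lt_trans; apply.
- by move: bz; rewrite /below; case: (hi p) => // w; apply: lt_trans.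
Qed.

(** Two edges leave the group, and at most five follow in a cell. *)
Lemma depth_adr x : depth_in (phys (qsub Q (adr x))) x <= 7.
Proof.
set p := adr x; have le : size p <= h := size_adr x.
have cell c : size p = h -> depth_in (phys (qsub Q (rcons p c))) x <= 5.
  move=> E; have := @perfect_qsub _ _ h.+1 Q (rcons p c) Qperf.
  rewrite size_rcons E subnn => /(_ (leqnn _)); case: (qsub _ _) => //= s.
  exact/leq_trans/depth_spine.
have leaf c : (if c then (kD p < x)%O else (x < kA p)%O) -> size p = h.
  move=> hc; apply/eqP; rewrite eqn_leq le leqNgt; apply/negP => lt.
  have := @prefix_adr_rcons x p c lt (prefix_refl _); rewrite hc => /prefix_size.
  by rewrite size_rcons ltnn.
rewrite (qsubE le) /=; do 2?case: ifP => //= _.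
- case: ifP => // _; case: ifP => // xa.
  by rewrite !ltnS; apply: (cell false); apply: (leaf false).
- case: ifP => // xd; case: ifP => // ltd; first by case: ifP => //; case: ifP.
  rewrite !ltnS; apply: (cell true); apply: (leaf true).
  by rewrite lt_neqAle eq_sym xd leNgt ltd.
Qed.

(** The four keys of [q] itself count as part of its left side. *)
Definition reg q : region K :=
  Region (fun x => prefix q (adr x)) (fun x => prefix (rcons q true) (adr x)).

Lemma reg_proper q : size q < h -> proper_region (reg q).
Proof.
move=> lt; have le := ltnW lt; split=> [x /= /prefix_rconsl //| |b|b].
- exact: convex_prefix.
- case: b; first by apply: convex_prefix; rewrite size_rcons.
  move=> x y z /andP[px _] /andP[pz nz] xy yz; rewrite /= /leftp /=.
  have py := convex_prefix le px pz xy yz; rewrite py /=; apply: contra nz.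
  by rewrite /= !prefix_adr_rcons //= => dy; apply: lt_trans dy yz.
- case: b.
    exists (kB (rcons q true)); have [|_ E _ _] := @adr_quad (rcons q true).
      by rewrite size_rcons.
    by rewrite /= E prefix_refl.
  exists (kB q); have [_ E _ _] := adr_quad le; rewrite /= /leftp /= E prefix_refl /=.
  by apply/negP => /prefix_size; rewrite size_rcons ltnn.
Qed.

(** Two different addresses are either comparable, which makes the regions nested, or incomparable,
    which makes them apart. *)
Lemma reg_distinct q1 q2 t z : size q1 < h -> size q2 < h -> bst t ->
  transition (reg q1) t = Some z -> transition (reg q2) t = Some z -> q1 = q2.
Proof.
move=> l1 l2 bt t1 t2; apply/eqP; apply: contraT => ne.
have P1 := reg_proper l1; have P2 := reg_proper l2.
have nest p q : prefix p q -> p != q -> nested (reg p) (reg q).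
  move=> pq npq; have lt : size p < size q.
    by rewrite ltnNge; apply: contraNN npq => /(prefix_eq pq) ->.
  have [c pc] := prefix_strict pq lt; exists c => x /= qx.
  have px := prefix_trans pc qx; case: c pc px => //= pc px; rewrite /leftp /=.
  by rewrite (prefix_rconsl px) /=; apply/negP => /(prefix_rcons2 px).
have [p12|n12] := boolP (prefix q1 q2).
  by case: (transition_nested bt P1 P2 (nest _ _ p12 ne) t1 t2).
have [p21|n21] := boolP (prefix q2 q1).
  by case: (transition_nested bt P2 P1 (nest _ _ p21 _) t2 t1); rewrite // eq_sym.
case: (transition_apart bt P1 P2 _ t1 t2) => x /= px qx.
case: (leqP (size q1) (size q2)) => [le|/ltnW le].
- by rewrite (prefix_total px qx le) in n12.
- by rewrite (prefix_total qx px le) in n21.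
Qed.

Lemma bst_phys : bst (phys Q).
Proof. by split; rewrite inorder_phys. Qed.

Lemma top_phys (w : qtree K) I p l a b (c' e : K) r : sorted <%O (keys w) ->
  (forall x, x \in keys w -> I x = (x \in keys (qsub w p))) ->
  qsub w p = Quad l a b c' e r -> top I (phys w) = Some b.
Proof.
move: c' => c; elim: p w => [|c' p IH] [s|l1 a1 b1 c1 e1 r1] //= so HI.
  by case=> *; subst; rewrite HI ?ifT //= !(mem_cat, inE) eqxx !orbT.
move=> E; have [sl sr hl hr [ab bc ce]] := sorted_quad so.
have np y z : (y < z)%O -> (z < y)%O = false.
  by move=> yz; apply/negP => /(lt_trans yz); rewrite ltxx.
have bI : b \in keys (qsub (if c' then r1 else l1) p).
  by rewrite E /= !(mem_cat, inE) eqxx !orbT.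
have HIs x : x \in keys (if c' then r1 else l1) -> I x =
    (x \in keys (qsub (if c' then r1 else l1) p)).
  by move=> xk; apply: HI; rewrite mem_cat !inE; case: (c') xk => ->; rewrite ?orbT.
have := IH (if c' then r1 else l1) _ HIs E; case: c' E bI HI HIs {IH} => E bI HI HIs H.
- have out y : (y <= e1)%O -> (y \in keys (qsub r1 p)) = false.
    by move=> ye; apply/negP => /keys_qsub /hr; rewrite ltNge ye.
  have be := lt_trans bc ce; have ae := lt_trans ab be.
  have nl : has I (keys l1) = false.
    apply/hasPn => y yl; rewrite HI ?mem_cat ?yl // out //.
    by apply: ltW; apply: lt_trans (hl _ yl) _.
  rewrite has_cat /= inorder_phys nl /= !HI ?(mem_cat, inE) ?eqxx ?orbT //.
  rewrite !out ?lexx ?ltW //=; exact: H.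
- have out y : (a1 <= y)%O -> (y \in keys (qsub l1 p)) = false.
    by move=> ye; apply/negP => /keys_qsub /hl; rewrite ltNge ye.
  have hIl : has I (keys l1).
    by apply/hasP; exists b; [exact: keys_qsub bI|rewrite HIs // (keys_qsub bI)].
  rewrite has_cat /= inorder_phys hIl /= !HI ?(mem_cat, inE) ?eqxx ?orbT //.
  rewrite !out ?lexx ?ltW //=; exact: H.
Qed.

(** The highest node of the range in the initial tree is [kB q], which belongs to the left side. *)
Lemma low_side_phys q : size q < h -> low_side (reg q) (phys Q).
Proof.
move=> lt; have le := ltnW lt.
have := top_phys (I := whole (reg q)) Qsort _ (qsubE le) => H.
rewrite /low_side H /=; last by move=> x _; rewrite prefix_adr.
have [_ -> _ _] := adr_quad le.
by apply/negP => /prefix_size; rewrite size_rcons ltnn.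
Qed.

End Layout.

(** * Preferred paths and the lower bound *)

(* [b p] is the address of the leaf at the end of the preferred path through p. *)
Record bottoms (h : nat) (b : seq bool -> seq bool) : Prop := Bottoms {
  bot_prefix : forall p, size p <= h -> prefix p (b p);
  bot_size : forall p, size p <= h -> size (b p) = h;
  bot_coherent : forall p q, size p <= h -> prefix p q -> prefix q (b p) -> b q = b p }.

(** Effect of an access to address [a]: the nodes above [a] now prefer the way to [a], and below [a]
    the old preferred path is kept. *)
Definition rebottom (b : seq bool -> seq bool) (a p : seq bool) :=
  if prefix p a then b a else b p.

Definition leftmost (h : nat) (p : seq bool) := p ++ nseq (h - size p) false.

Lemma bottoms_leftmost h : bottoms h (leftmost h).
Proof.
split=> [p _|p le|p q le /prefixP[s ->]]; rewrite /leftmost ?prefix_prefix //.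
  by rewrite size_cat size_nseq subnKC.
rewrite prefix_catr // eqxx /= => sp.
suff -> : s = nseq (size s) false.
  rewrite -catA size_cat size_nseq -nseqD; congr (_ ++ nseq _ _).
  have := prefix_size sp; move: le; rewrite size_nseq.
  by move: (size s) (size p) => m n; lia.
have := sp; rewrite prefixE => /eqP {1}<-; rewrite take_nseq //.
by have := prefix_size sp; rewrite size_nseq.
Qed.

Lemma bottoms_rebottom h b a : size a <= h -> bottoms h b -> bottoms h (rebottom b a).
Proof.
move=> la [bp bs bc]; rewrite /rebottom; split=> [p le|p le|p q le pq].
- case: ifP => [pa|_]; last exact: bp.
  exact: prefix_trans pa (bp _ la).
- by case: ifP => _; apply: bs.
- case: (boolP (prefix p a)) => pa qb.
    case: ifP => // /negP nqa; apply: bc => //.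
    apply: (prefix_total (bp _ la) qb); rewrite leqNgt; apply/negP => lt; apply: nqa.
    exact: prefix_total qb (bp _ la) (ltnW lt).
  rewrite ifF; first exact: bc.
  by apply: contraNF pa; apply: prefix_trans.
Qed.

Definition preferred (b : seq bool -> seq bool) q := prefix (rcons q true) (b q).

Definition changed (b : seq bool -> seq bool) (a q : seq bool) : bool :=
  [&& prefix q a, size q < size a & ~~ prefix (take (size q).+1 a) (b q)].

(** The starting depth [n] allows counting the changes that remain in the middle of an access. *)
Definition changes_from b a n :=
  count (changed b a) [seq take i a | i <- iota n (size a - n)].

Fixpoint bits (n : nat) : seq (seq bool) :=
  if n is m.+1 then
    [::] :: [seq false :: s | s <- bits m] ++ [seq true :: s | s <- bits m]
  else [::].

Lemma mem_bits n s : (s \in bits n) = (size s < n).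
Proof.
elim: n s => //= n IH [|c s]; rewrite inE //= mem_cat ltnS -IH.
have E c' : (c :: s \in [seq c' :: s0 | s0 <- bits n]) = (c == c') && (s \in bits n).
  apply/mapP/andP => [[s0 m0 [-> ->]]|[/eqP-> m0]]; first by rewrite eqxx.
  by exists s.
by rewrite !E; case: (c); rewrite ?orbF.
Qed.

Lemma uniq_bits n : uniq (bits n).
Proof.
elim: n => //= n IH; rewrite cat_uniq !map_inj_uniq ?IH //; last by move=> ? ? [].
  rewrite mem_cat /= andbT; apply/andP; split.
    by rewrite negb_or; apply/andP; split; apply/mapP => -[].
  by apply/hasPn => s /mapP[s1 _ ->]; apply/mapP => -[].
by move=> ? ? [].
Qed.

Lemma count_potential (T : eqType) (s : seq T) (c f f' w : pred T) :
  {in s, forall q, c q + f' q <= f q + 2 * w q} ->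
  count c s + count f' s <= count f s + 2 * count w s.
Proof.
elim: s => //= q s IH H; have := H q (mem_head _ _).
have := IH (fun q' m => H q' (mem_behead (s := q :: s) m)); lia.
Qed.

(** * Amortised bound on the changes of preferred children *)

Section Potential.
Variables (d : Order.disp_t) (K : finOrderType d).
Variables (h : nat) (Q : qtree K) (x0 : K).
Hypothesis Qperf : perfect h.+1 Q.
Hypothesis Qsort : sorted <%O (keys Q).
Hypothesis Qall : forall x, x \in keys Q.
Implicit Types (x : K) (q : seq bool) (t : tree K).

Let addr_of := adr h Q.

(* A node whose next change of preferred child would be free for the optimum. *)
Definition loaded b t q : bool := low_side (reg h Q q) t == preferred b q.

Definition potential b t := count (loaded b t) (bits h).

Lemma potential_leftmost : potential (leftmost h) (phys Q) = 0.
Proof.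
apply/eqP; rewrite /potential -leqn0 leqNgt -has_count; apply/hasPn => q.
rewrite mem_bits => lt.
rewrite /loaded (low_side_phys x0 Qperf Qsort Qall lt) /preferred /leftmost.
have -> : h - size q = (h - (size q).+1).+1 by lia.
rewrite /= -cat_rcons; have [p|//] := boolP (prefix (rcons q true) _).
by have := prefix_rcons2 p (prefix_prefix _ _).
Qed.

(** Distinct reference nodes own distinct keys [kB]. *)
Lemma potential_le_card b t : potential b t <= #|K|.
Proof.
have : uniq [seq kB Q x0 q | q <- bits h].
  rewrite map_inj_in_uniq ?uniq_bits // => p q; rewrite !mem_bits => lp lq E.
  have [_ <- _ _] := adr_quad x0 Qperf Qsort Qall (ltnW lp).
  by have [_ <- _ _] := adr_quad x0 Qperf Qsort Qall (ltnW lq); rewrite E.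
move=> /card_uniqP E; apply: leq_trans (count_size _ _) _.
by rewrite -(size_map (kB Q x0)) -E; apply: max_card.
Qed.

Lemma changes_le b a : size a <= h ->
  changes_from b a 0 <= count (changed b a) (bits h).
Proof.
move=> le; rewrite /changes_from subn0; set s := map _ _.
have us : uniq s.
  rewrite map_inj_in_uniq ?iota_uniq // => i j; rewrite !mem_iota /= add0n => li lj.
  by move=> /(congr1 size); rewrite !size_takel ?(ltnW li) ?(ltnW lj).
rewrite -!size_filter; apply: uniq_leq_size; first exact: filter_uniq.
move=> q; rewrite !mem_filter => /andP[-> /mapP[i]].
rewrite mem_iota add0n /= => li ->.
by rewrite mem_bits size_takel ?(ltnW li) // (leq_trans li).
Qed.

(** The inequality holds node by node: a touched transition point pays 2, for a change and for
    becoming loaded; at any other node a change uses up the load. *)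
Lemma potential_access b t x t' m : bottoms h b -> bst t -> bst_access t x t' m ->
  changes_from b (addr_of x) 0 + potential (rebottom b (addr_of x)) t' <=
  potential b t + 2 * m.
Proof.
move=> [bp bs bc] bt acc; set a := addr_of x.
have la : size a <= h := size_adr h Q x.
have [A [-> bt' xA H]] := bst_access_transition bt acc.
pose z q := odflt x0 (transition (reg h Q q) t).
have tz q : size q < h -> transition (reg h Q q) t = Some (z q).
  move=> lt; have [y [ty _ _]] := transition_ex (reg_proper x0 Qperf Qsort Qall lt) bt.
  by rewrite /z ty.
(* Transition points of distinct nodes are distinct, so at most [#|A|] nodes are charged. *)
apply: (@leq_trans (potential b t + 2 * count (fun q => z q \in A) (bits h))); last first.
  rewrite leq_add2l leq_mul2l /= -size_filter cardE -(size_map z).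
  apply: uniq_leq_size.
    rewrite map_inj_in_uniq ?filter_uniq ?uniq_bits // => p q.
    rewrite !mem_filter !mem_bits => /andP[_ lp] /andP[_ lq] E.
    apply: (reg_distinct x0 Qperf Qsort Qall lp lq bt (tz _ lp)).
    by rewrite E; apply: tz.
  by move=> y /mapP[q]; rewrite mem_filter mem_enum => /andP[? _] ->.
apply: leq_trans (leq_add (changes_le b la) (leqnn _)) _.
apply: count_potential => q; rewrite mem_bits => lt.
have rP := reg_proper x0 Qperf Qsort Qall lt.
have [touch stay] := H _ rP _ (tz _ lt).
have [zA|zA] := boolP (z q \in A).
  by case: (changed _ _ _); case: (loaded _ _ _); case: (loaded _ _ _).
(* With [z q] untouched, the low side stays and does not contain [x]. If [q] lies strictly above
   [a], its new preferred child is off the low side, so [q] ends unloaded, and it was loaded if its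
   preferred child changed. *)
rewrite muln0 addn0 /loaded stay //.
have nt : side (reg h Q q) (low_side (reg h Q q) t) x = false.
  by apply: contraNF zA => /touch.
have le := ltnW lt.
have [qa|nqa] := boolP (prefix q a); last first.
  by rewrite /changed (negbTE nqa) /preferred /rebottom (negbTE nqa).
have [ltq|geq] := ltnP (size q) (size a); last first.
  (* The access ends at [a], whose own preferred child is left as it was. *)
  have E := prefix_eq qa geq; subst q.
  by rewrite /changed ltnn andbF /= /preferred /rebottom prefix_refl.
have [c ca] := prefix_strict qa ltq.
have caba := prefix_trans ca (bp _ la).
have aE : take (size q).+1 a = rcons q c.
  by move: ca; rewrite prefixE size_rcons => /eqP.
have pE : preferred (rebottom b a) q = c.
  rewrite /preferred /rebottom qa; case: c ca caba aE => // ca caba aE.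
  by apply/negP => /(prefix_rcons2 caba).
have sx : side (reg h Q q) c x.
  case: c ca {caba aE pE} => //= ca; rewrite /leftp /= -/a qa /=.
  by apply/negP => /(prefix_rcons2 ca).
have nl : low_side (reg h Q q) t = ~~ c.
  by move: nt; case: (low_side _ _) (c) sx => -[] //= ->.
rewrite /changed qa ltq aE /= pE nl prefix_rcons_neg ?bp ?bs // /preferred.
rewrite -[prefix (rcons q true) _]negbK (prefix_rcons_neg _ (bp _ le)) ?bs //.
case: c {ca caba aE pE sx nl} => /=.
- by case: (prefix _ _).
- rewrite -(prefix_rcons_neg false (bp _ le)) ?bs //; by case: (prefix _ _).
Qed.

End Potential.

(** * The program *)

(* Preorder numbering of a complete binary tree with [2 ^ n - 1] nodes, here the
   heights above a leaf: a node y of level j has children y + 1 and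
   y + 2 ^ (j - 1), reached by the parent pointer and by the jump pointer. *)
Fixpoint level (n y : nat) : nat :=
  if n is m.+1 then
    if y == 0 then n
    else if y < 2 ^ m then level m y.-1 else level m (y - 2 ^ m)
  else 0.

Lemma level_bound n y : 0 < level n y -> y + 2 ^ level n y <= 2 ^ n.
Proof.
elim: n y => //= n IH y; have [->//|y0] := eqVneq y 0.
by case: (ltnP y (2 ^ n)) => lt /IH; rewrite expnS; lia.
Qed.

Lemma level_children n y j : level n y = j.+2 ->
  level n y.+1 = j.+1 /\ level n (y + 2 ^ j.+1) = j.+1.
Proof.
elim: n y => //= n IH y; have [->|y0] := eqVneq y 0.
  case=> ->; rewrite add0n ltnn subnn gtn_eqF ?expn_gt0 //.
  have -> : 1 < 2 ^ j.+1 by rewrite -{1}(expn0 2) ltn_exp2l.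
  by split; rewrite //=; case: (j).
have yE : y = y.-1.+1 by case: (y) y0.
have p1 : 1 < 2 ^ j.+1 by rewrite -{1}(expn0 2) ltn_exp2l.
case: (ltnP y (2 ^ n)) => lt E; have [e1 e2] := IH _ E.
  have := @level_bound n y.-1; rewrite E (expnS 2 j.+1) => /(_ isT) bd.
  have -> : y.+1 < 2 ^ n by move: bd p1; move: (2 ^ j.+1) (2 ^ n) => u v; lia.
  have -> : (y + 2 ^ j.+1 == 0) = false by move: p1; move: (2 ^ j.+1) => u; lia.
  have -> : y + 2 ^ j.+1 < 2 ^ n by move: bd p1; move: (2 ^ j.+1) (2 ^ n) => u v; lia.
  split; first by rewrite -e1 -yE.
  by rewrite -[RHS]e2; congr level; move: (2 ^ j.+1) => u; lia.
have -> : (y.+1 < 2 ^ n) = false by move: lt; move: (2 ^ n) => u; lia.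
have -> : (y + 2 ^ j.+1 == 0) = false by move: p1; move: (2 ^ j.+1) => u; lia.
have -> : (y + 2 ^ j.+1 < 2 ^ n) = false.
  by move: lt; move: (2 ^ j.+1) (2 ^ n) => u v; lia.
by rewrite subSn // -addnBAC.
Qed.

Local Notation hmem := Defs.mem.

(** * Timed total correctness, and plain search in a linked tree *)

Section Run.
Variables (W : nat) (d : Order.disp_t) (K : finOrderType d) (x : K) (k : nat).
Implicit Types (s : machine k K) (c : cmd k) (R : machine k K -> Prop).

Definition run (n : nat) c s R := exists s' t, [/\ exec W x c s s' t, t <= n & R s'].

Lemma run_le n n' c s R : run n c s R -> n <= n' -> run n' c s R.
Proof. by move=> [s' [t [e l r]]] le; exists s', t; split=> //; apply: leq_trans le. Qed.

Lemma run_mono n c s R R' : run n c s R -> (forall s', R s' -> R' s') -> run n c s R'.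
Proof. by move=> [s' [t [e l r]]] H; exists s', t; split=> //; apply: H. Qed.

Lemma run_instr i s s' R : eval_instr W s i = Some s' -> R s' -> run 1 (CInstr i) s R.
Proof. by move=> e r; exists s', 1; split=> //; constructor. Qed.

Lemma run_seq n1 n2 c1 c2 s R :
  run n1 c1 s (fun s1 => run n2 c2 s1 R) -> run (n1 + n2) (CSeq c1 c2) s R.
Proof.
move=> [s1 [t1 [e1 l1 [s2 [t2 [e2 l2 r]]]]]]; exists s2, (t1 + t2).
by split=> //; [apply: exec_seq e1 e2 | apply: leq_add].
Qed.

Lemma run_cons n i c s s1 R : eval_instr W s i = Some s1 -> run n c s1 R ->
  run n.+1 (CSeq (CInstr i) c) s R.
Proof. by move=> e r; rewrite -add1n; apply: run_seq; apply: run_instr e r. Qed.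

Lemma run_if n b c1 c2 v s R : eval_test x s b = Some v ->
  run n (if v then c1 else c2) s R -> run n.+1 (CIf b c1 c2) s R.
Proof.
by move=> e [s' [t [e1 l r]]]; exists s', t.+1; split=> //; apply: exec_if e e1.
Qed.

Lemma run_while_stop b c s R : eval_test x s b = Some false -> R s ->
  run 1 (CWhile b c) s R.
Proof. by move=> e r; exists s, 1; split=> //; apply: exec_while_stop. Qed.

Lemma run_while_loop n1 n2 b c s R : eval_test x s b = Some true ->
  run n1 c s (fun s1 => run n2 (CWhile b c) s1 R) ->
  run (n1 + n2).+1 (CWhile b c) s R.
Proof.
move=> e [s1 [t1 [e1 l1 [s2 [t2 [e2 l2 r]]]]]]; exists s2, (t1 + t2).+1.
by split=> //; [apply: exec_while_loop e e1 e2 | apply: leq_add].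
Qed.

Definition keeps (l : seq nat) s s' :=
  hmem s' = hmem s /\ forall i, i \notin l -> preg s' i = preg s i.

Lemma keeps_trans l1 l2 l s s1 s2 : keeps l1 s s1 -> keeps l2 s1 s2 ->
  {subset l1 <= l} -> {subset l2 <= l} -> keeps l s s2.
Proof.
move=> [m1 k1] [m2 k2] s1l s2l; split=> [|i il]; first by rewrite m2.
by rewrite k2 ?k1 //; apply: contra il; [apply: s1l | apply: s2l].
Qed.

Definition search_down : cmd k :=
  CWhile (TNot (TSearchEq 1))
    (CIf (TSearchLt 1) (CInstr (ILoad 1 1 PLeft)) (CInstr (ILoad 1 1 PRight))).

(** Each edge costs three steps: loop test, comparison, load. *)
Lemma run_search_down par v t s : linked (hmem s) par v t ->
  sorted <%O (inorder t) -> x \in inorder t -> preg s 1 = v ->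
  run (3 * depth_in t x).+1 search_down s
    (fun s' => keeps [:: 1] s s' /\ preg s' 1 = Some x).
Proof.
elim: t par v s => // l IHl a r IHr par v s /= [-> _ ll lr] so xt s1.
have [sl sr hl hr] := sorted_node so.
have [xa|xa] := eqVneq x a.
  by subst a; apply: run_while_stop; rewrite /= s1 ?eqxx.
have ev : eval_test x s (TNot (TSearchEq 1)) = Some true by rewrite /= s1 (negbTE xa).
have step f (t : tree K) : linked (hmem s) (Some a) (ptr (hmem s) f a) t ->
  (forall s, linked (hmem s) (Some a) (ptr (hmem s) f a) t ->
    preg s 1 = ptr (hmem s) f a ->
    run (3 * depth_in t x).+1 search_down s
      (fun s' => keeps [:: 1] s s' /\ preg s' 1 = Some x)) ->
  run 1 (CInstr (ILoad 1 1 f)) s (fun s1 => run (3 * depth_in t x).+1 search_down s1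
      (fun s' => keeps [:: 1] s s' /\ preg s' 1 = Some x)).
  move=> lt H; apply: run_instr; first by rewrite /= s1.
  apply: run_mono (H _ _ _) _ => // s' [[m1 k1] p1]; split=> //; split=> // i il.
  rewrite k1 //= /upd; move: il; rewrite inE => /negbTE -> //.
have xlr : (x \in inorder l) || (x \in inorder r).
  by move: xt; rewrite mem_cat inE (negbTE xa).
case: ifP => lt.
- have xl : x \in inorder l.
    by case/orP: xlr => // /hr xr; have := lt_trans lt xr; rewrite ltxx.
  apply: (@run_le (2 + (3 * depth_in l x).+1).+1); last by rewrite mulnS.
  apply: run_while_loop ev _.
  apply: run_if; first by rewrite /= s1.
  rewrite lt; apply: step => //.
  by move=> s2 l2 p2; apply: IHl l2 sl xl p2.
- have xr : x \in inorder r.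
    by case/orP: xlr => // /hl; rewrite lt.
  apply: (@run_le (2 + (3 * depth_in r x).+1).+1); last by rewrite mulnS.
  apply: run_while_loop ev _.
  apply: run_if; first by rewrite /= s1.
  rewrite lt; apply: step => //.
  by move=> s2 l2 p2; apply: IHr l2 sr xr p2.
Qed.

End Run.

Notation "c1 ;; c2" := (CSeq c1 c2) (at level 61, right associativity).

(* Pointer registers: 0 root, 1 result, 2 start of the walk down, 3 bottom of the
   current path, 4 position of the walk up, 5 meeting point once found, 6 and 7
   first and last key of a reference node, 8 and 9 bounds of a range, 10 jump. *)
Definition load p q f : cmd 0 := CInstr (ILoad p q f).
Definition move p q : cmd 0 := CInstr (IMove p q).
Definition save p q : cmd 0 := CInstr (IStore p PExtra q).

Definition t_gt r := TAnd (TNot (TSearchLt r)) (TNot (TSearchEq r)).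

(** A nil register is an absent bound. Both conjuncts are implications written with the lazy [TAnd],
    so that nil is never compared. *)
Definition t_inside :=
  TAnd (TNot (TAnd (TNot (TNil 8)) (TNot (t_gt 8))))
       (TNot (TAnd (TNot (TNil 9)) (TNot (TSearchLt 9)))).

(** From [kB v] the right child is [kD v], which holds the upper bound; the left child of [kD v] is
    [kC v], which holds the lower one. *)
Definition load_bounds r : cmd 0 :=
  load 8 r PRight ;; load 9 8 PExtra ;; load 8 8 PLeft ;; load 8 8 PExtra.

Definition step_down : cmd 0 :=
  load 6 2 PLeft ;; load 7 2 PRight ;;
  CIf (TAnd (TSearchLt 6) (TKeyLt 3 6)) (load 2 6 PLeft)
    (CIf (TAnd (t_gt 7) (TKeyLt 7 3)) (load 2 7 PRight) (move 5 2)).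

(** A jump whose target contains [x] might pass the meeting point, so the reference parent, two
    edges up, is taken instead. *)
Definition step_up : cmd 0 :=
  load_bounds 4 ;;
  CIf t_inside (move 5 4)
    (load 10 4 PExtra ;; load_bounds 10 ;;
     CIf t_inside (load 4 4 PParent ;; load 4 4 PParent) (move 4 10)).

(** Alternating the two searches makes the cost proportional to the shorter of them; [move 6 6] does
    nothing. *)
Definition meet_loop : cmd 0 :=
  CWhile (TNil 5) (step_down ;; CIf (TNil 5) step_up (move 6 6)).

Definition find_meet : cmd 0 :=
  load 6 2 PLeft ;; load 3 6 PExtra ;; move 4 3 ;; CInstr (INil 5) ;;
  meet_loop ;; load 6 5 PLeft ;; load 7 5 PRight.

(** Comparing registers 5 and 3 stops the descent at a reference leaf, below which there are only
    cells. The saved pointer goes to the [kA] key of the abandoned child. *)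
Definition phase : cmd 0 :=
  find_meet ;;
  CIf (TAnd (TSearchLt 6) (TNot (TSame 5 3)))
    (load 2 6 PLeft ;; load 8 7 PRight ;; load 8 8 PLeft ;; save 8 3)
    (CIf (TAnd (t_gt 7) (TNot (TSame 5 3)))
      (load 2 7 PRight ;; load 8 6 PLeft ;; load 8 8 PLeft ;; save 8 3)
      (move 1 5)).

(** The phases end at the group addressed by [adr h Q x]. The bottom of the last path then becomes
    that of the root, and a plain search finishes within the group or a cell below it. *)
Definition hybrid : cmd 0 :=
  move 2 0 ;; CWhile (TNil 1) phase ;;
  load 6 0 PLeft ;; save 6 3 ;; search_down 0.

Lemma meet_ex (a b : seq bool) : exists y, [/\ prefix y a, prefix y b &
  forall c, ~~ (prefix (rcons y c) a && prefix (rcons y c) b)].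
Proof.
elim: a b => [|c a IH] [|c' b]; try by exists [::]; split=> // c0; rewrite /= ?andbF.
have [->|ne] := eqVneq c c'; last first.
  exists [::]; rewrite !prefix0s; split=> // c0 /=; rewrite !prefix0s !andbT.
  by apply: contraNN ne => /andP[/eqP<- /eqP<-].
have [y [ya yb ym]] := IH b; exists (c' :: y); by rewrite /= eqxx ya yb.
Qed.

(** * Correctness and running time of one access *)

Section Machine.
Variables (d : Order.disp_t) (K : finOrderType d).
Variables (h : nat) (Q : qtree K) (x0 : K).
Hypothesis Qperf : perfect h.+1 Q.
Hypothesis Qsort : sorted <%O (keys Q).
Hypothesis Qall : forall x, x \in keys Q.
Variables (n : nat) (W : nat).
Hypothesis hn : h < 2 ^ n.
Implicit Types (x : K) (p q : seq bool) (m : heap 0 K) (s : machine 0 K).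

Local Notation A := (kA Q x0).
Local Notation B := (kB Q x0).
Local Notation C := (kC Q x0).
Local Notation D := (kD Q x0).
Local Notation lo := (lo Q x0).
Local Notation hi := (hi Q x0).
Local Notation adr := (adr h Q).

(* The truncated subtraction sends jumps past the root to the root. *)
Definition jump p := take (size p - 2 ^ (level n (h - size p)).-1) p.

Record static m : Prop := Static {
  st_linked : linked m None (Some (B [::])) (phys Q);
  st_jump : forall p, size p <= h -> ptr m PExtra (B p) = Some (B (jump p));
  st_lo : forall p, size p <= h -> ptr m PExtra (C p) = lo p;
  st_hi : forall p, size p <= h -> ptr m PExtra (D p) = hi p }.

Definition parent_ptr p : option K :=
  if rev p is c :: q then Some (if c then D (rev q) else A (rev q)) else None.

Lemma linked_qsub m p : static m -> size p <= h ->
  linked m (parent_ptr p) (Some (B p)) (phys (qsub Q p)).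
Proof.
move=> [li _ _ _]; elim/last_ind: p => [_|p c IH]; first exact: li.
rewrite size_rcons => lt; have := IH (ltnW lt).
rewrite (qsubE x0 Qperf (ltnW lt)) /parent_ptr rev_rcons revK.
move=> /= [_ _ [_ _ lA _] [_ _ _ lD]].
have sz : size (rcons p c) <= h by rewrite size_rcons.
case: c sz => sz.
- by have := lD; rewrite {1}(qsubE x0 Qperf sz) /= => -[<- _ _ _].
- by have := lA; rewrite {1}(qsubE x0 Qperf sz) /= => -[<- _ _ _].
Qed.

Lemma static_ptr m p : static m -> size p <= h ->
  [/\ ptr m PLeft (B p) = Some (A p), ptr m PRight (B p) = Some (D p),
      ptr m PLeft (D p) = Some (C p), ptr m PParent (A p) = Some (B p) &
      ptr m PParent (D p) = Some (B p)].
Proof.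
move=> st le; have := linked_qsub st le; rewrite (qsubE x0 Qperf le) /=.
by case=> _ _ [-> -> _ _] [-> -> [-> _ _ _] _].
Qed.

Lemma static_child m p : static m -> size p < h ->
  ptr m PLeft (A p) = Some (B (rcons p false)) /\
  ptr m PRight (D p) = Some (B (rcons p true)).
Proof.
move=> st lt; have := linked_qsub st (ltnW lt); rewrite (qsubE x0 Qperf (ltnW lt)) /=.
have sz c : size (rcons p c) <= h by rewrite size_rcons.
case=> _ _ [_ _ + _] [_ _ _ +].
rewrite (qsubE x0 Qperf (sz false)) (qsubE x0 Qperf (sz true)) /=.
by move=> -[-> _ _ _] [-> _ _ _].
Qed.

Lemma static_parent m p c : static m -> size p < h ->
  ptr m PParent (B (rcons p c)) = Some (if c then D p else A p).
Proof.
move=> st lt; have := @linked_qsub m (rcons p c) st; rewrite size_rcons => /(_ lt).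
by rewrite (qsubE x0 Qperf) ?size_rcons //= /parent_ptr rev_rcons revK => -[_ ->].
Qed.

Lemma quad_neq p q : size p <= h -> size q <= h ->
  [/\ B p != A q, C p != A q & D p != A q].
Proof.
move=> lp lq; have [_ aB aC aD] := adr_quad x0 Qperf Qsort Qall lp.
have [aA _ _ _] := adr_quad x0 Qperf Qsort Qall lq.
have [ab bc cd] := quad_lt x0 Qperf Qsort lq.
have ac := lt_trans ab bc; have ad := lt_trans ac cd.
by split; apply/eqP => E; have := aA; rewrite -E ?aB ?aC ?aD => pq; subst q;
  move: E => /eqP; rewrite gt_eqF.
Qed.

Lemma kA_inj p q : size p <= h -> size q <= h -> A p = A q -> p = q.
Proof.
move=> lp lq E; have [<- _ _ _] := adr_quad x0 Qperf Qsort Qall lp.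
by have [<- _ _ _] := adr_quad x0 Qperf Qsort Qall lq; rewrite E.
Qed.

Lemma kB_inj p q : size p <= h -> size q <= h -> B p = B q -> p = q.
Proof.
move=> lp lq E; have [_ <- _ _] := adr_quad x0 Qperf Qsort Qall lp.
by have [_ <- _ _] := adr_quad x0 Qperf Qsort Qall lq; rewrite E.
Qed.

Lemma linked_ext m m' par v t :
  (forall f a, ~~ ptr_field_eqb f PExtra -> ptr m' f a = ptr m f a) ->
  linked m par v t -> linked m' par v t.
Proof.
move=> E; elim: t par v => //= l IHl a r IHr par v [-> e1 l1 l2].
by rewrite !E //; split=> //; [apply: IHl | apply: IHr].
Qed.

(** Saved bottoms live in the [kA] keys, which differ from all keys holding jumps and bounds. *)
Lemma static_save s p v : size p <= h -> static (hmem s) ->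
  static (hmem (set_ptr s PExtra (A p) v)).
Proof.
move=> lp [li sj sl sh]; split=> [|q lq|q lq|q lq] /=.
- by apply: linked_ext li => -[].
all: rewrite /upd; have [n1 n2 n3] := quad_neq lq lp.
- by rewrite (negbTE n1) sj.
- by rewrite (negbTE n2) sl.
- by rewrite (negbTE n3) sh.
Qed.

Variable x : K.
Let a := adr x.

Lemma run_load_bounds r v s : static (hmem s) -> r \notin [:: 8; 9] ->
  preg s r = Some (B v) -> size v <= h ->
  run W x 4 (load_bounds r) s
    (fun s' => [/\ keeps [:: 8; 9] s s', preg s' 8 = lo v & preg s' 9 = hi v]).
Proof.
move=> st rn sr lv; have [_ pr pl _ _] := static_ptr st lv.
apply: run_cons; first by rewrite /= sr pr.
apply: run_cons; first by rewrite /= (st_hi st).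
apply: run_cons; first by rewrite /= pl.
apply: run_instr; first by rewrite /= (st_lo st).
split=> //; split=> // i; rewrite /= /upd !inE negb_or => /andP[/negbTE -> /negbTE ->] //.
Qed.

Lemma eval_and s b1 b2 v1 v2 : eval_test x s b1 = Some v1 ->
  eval_test x s b2 = Some v2 -> eval_test x s (TAnd b1 b2) = Some (v1 && v2).
Proof. by move=> /= -> ->; case: v1. Qed.

Lemma eval_gt s r y : preg s r = Some y -> eval_test x s (t_gt r) = Some (y < x)%O.
Proof.
move=> /= ->; rewrite /= [in RHS]lt_neqAle leNgt eq_sym.
by case: (x < y)%O; rewrite ?andbT ?andbF.
Qed.

Lemma eval_inside s v : size v <= h -> preg s 8 = lo v -> preg s 9 = hi v ->
  eval_test x s t_inside = Some (prefix v a).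
Proof.
move=> lv e8 e9; rewrite (prefix_bounds x0 Qperf Qsort Qall) //.
have E1 : eval_test x s (TNot (TAnd (TNot (TNil 8)) (TNot (t_gt 8)))) =
    Some (above (lo v) x).
  move: e8; case: (lo v) => [y|] e8; last by rewrite /= e8.
  by have := eval_gt e8; rewrite /= e8 /= => ->; rewrite /= negbK.
have E2 : eval_test x s (TNot (TAnd (TNot (TNil 9)) (TNot (TSearchLt 9)))) =
    Some (below (hi v) x).
  by rewrite /= e9; case: (hi v) => [y|] //=; rewrite negbK.
exact: eval_and E1 E2.
Qed.

(** The key [kB b] stands for the address [b] in comparisons. At depth [h] one has [u = b], and
    [kB b] lies between [kA b] and [kD b], so both sides are false. *)
Lemma side_meet u b c : size u <= h -> prefix u a -> prefix u b -> size b = h ->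
  (if c then (D u < x)%O else (x < A u)%O) &&
    (if c then (D u < B b)%O else (B b < A u)%O) =
  prefix (rcons u c) a && prefix (rcons u c) b.
Proof.
move=> lu ua ub bh; have [_ aB _ _] := adr_quad x0 Qperf Qsort Qall (eq_leq bh).
move: lu; rewrite leq_eqVlt => /orP[/eqP uh|lt]; last first.
  have := prefix_adr_rcons x0 Qperf Qsort Qall (x := x) c lt ua => <-.
  have := prefix_adr_rcons x0 Qperf Qsort Qall (x := B b) c lt.
  by rewrite aB => /(_ ub) <-.
have E : u = b by apply: (prefix_eq ub); rewrite bh uh.
subst u; have [ab bc cd] := quad_lt x0 Qperf Qsort (eq_leq bh).
have bd := lt_trans bc cd.
have -> : prefix (rcons b c) b = false.
  by apply/negP => /prefix_size; rewrite size_rcons ltnn.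
by case: c; rewrite ?(lt_gtF bd) ?(lt_gtF ab) !andbF.
Qed.

Definition meet (y b : seq bool) := [/\ prefix y a, prefix y b &
  forall c, ~~ (prefix (rcons y c) a && prefix (rcons y c) b)].

Ltac keep := split; [by [] |
  let i := fresh "i" in let ni := fresh "ni" in
  intros i ni; rewrite /= /upd;
  repeat (case: eqP => [?|_]; first by subst i); by []].

Lemma run_step_down y b u s : meet y b -> static (hmem s) -> size b = h ->
  prefix u y -> preg s 2 = Some (B u) -> preg s 3 = Some (B b) -> preg s 5 = None ->
  run W x 5 step_down s (fun s' => keeps [:: 2; 5; 6; 7] s s' /\
    if u == y then preg s' 5 = Some (B y) else preg s' 5 = None /\
      exists2 c, prefix (rcons u c) y & preg s' 2 = Some (B (rcons u c))).
Proof.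
move=> [ya yb ym] st bh uy s2 s3 s5.
have ua := prefix_trans uy ya; have ub := prefix_trans uy yb.
have lu : size u <= h by rewrite -bh prefix_size.
have [pl pr _ _ _] := static_ptr st lu.
have SM := side_meet _ lu ua ub bh.
apply: run_cons; first by rewrite /= s2 pl.
apply: run_cons; first by rewrite /= /upd /= s2 pr.
set s1 := set_preg _ 7 _.
have e6 : preg s1 6 = Some (A u) by [].
have e7 : preg s1 7 = Some (D u) by [].
have e3 : preg s1 3 = Some (B b) by [].
have t1 : eval_test x s1 (TAnd (TSearchLt 6) (TKeyLt 3 6)) =
    Some (prefix (rcons u false) a && prefix (rcons u false) b).
  by rewrite -SM; apply: eval_and; rewrite /= /upd /= ?s3.
have t2 : eval_test x s1 (TAnd (t_gt 7) (TKeyLt 7 3)) =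
    Some (prefix (rcons u true) a && prefix (rcons u true) b).
  by rewrite -SM; apply: eval_and; [exact: eval_gt | rewrite /= /upd /= ?s3].
have [uE|un] := eqVneq u y.
  rewrite uE in t1 t2.
  apply: (run_if (n := 2)) t1 _; rewrite (negbTE (ym false)).
  apply: (run_if (n := 1)) t2 _; rewrite (negbTE (ym true)).
  apply: run_instr; first by [].
  by split; [keep | rewrite /= /upd /= s2 uE].
have ltu : size u < size y.
  by rewrite ltnNge; apply: contraNN un => /(prefix_eq uy) ->.
have lth : size u < h by rewrite -bh (leq_trans ltu) // prefix_size.
have [cl cr] := static_child st lth.
have [c cy] := prefix_strict uy ltu.
have ca := prefix_trans cy ya; have cb := prefix_trans cy yb.
case: c cy ca cb => cy ca cb.
- have nf : prefix (rcons u false) a && prefix (rcons u false) b = false.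
    by apply/negP => /andP[/(prefix_rcons2 ca)].
  apply: (run_if (n := 2)) t1 _; rewrite nf.
  apply: (run_if (n := 1)) t2 _; rewrite ca cb /=.
  apply: run_instr; first by rewrite /= /upd /= cr.
  by split; [keep | split=> //; exists true].
- apply: (run_if (n := 2)) t1 _; rewrite ca cb /=.
  apply: (run_le (n := 1)) => //.
  apply: run_instr; first by rewrite /= /upd /= cl.
  by split; [keep | split=> //; exists false].
Qed.

(** On the path to [b], containing [x] is monotone in the depth, which is what the upward search
    exploits. *)
Lemma meet_prefix y b v : meet y b -> prefix v b -> prefix v a = (size v <= size y).
Proof.
move=> [ya yb ym] vb; apply/idP/idP => [va|le]; last first.
  exact: prefix_trans (prefix_total vb yb le) ya.
rewrite leqNgt; apply/negP => lt.
have [c cv] := prefix_strict (prefix_total yb vb (ltnW lt)) lt.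
by have := ym c; rewrite (prefix_trans cv va) (prefix_trans cv vb).
Qed.

(* The invariant of the upward search: the meeting point lies less than [2 ^ j]
   above v, and v is either the meeting point or the root of a block of level j. *)
Definition within j (y v : seq bool) :=
  size v < size y + 2 ^ j /\ (0 < j -> level n (h - size v) = j).

Lemma run_step_up y b v j s : meet y b -> static (hmem s) -> size b = h ->
  prefix y v -> prefix v b -> within j y v ->
  preg s 4 = Some (B v) -> preg s 5 = None ->
  run W x 14 step_up s (fun s' => keeps [:: 4; 5; 8; 9; 10] s s' /\
    if v == y then preg s' 5 = Some (B y) else
    preg s' 5 = None /\ exists v', [/\ prefix y v', prefix v' b, 0 < j,
      within j.-1 y v' & preg s' 4 = Some (B v')]).
Proof.
move=> my st bh yv vb [dj lj] s4 s5; have [ya yb ym] := my.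
have lv : size v <= h by rewrite -bh prefix_size.
apply: (@run_seq _ _ _ _ _ 4 10).
apply: run_mono (run_load_bounds st _ s4 lv) _ => // s1 [[m1 k1] e8 e9].
have t1 := eval_inside lv e8 e9.
apply: (run_if (n := 9)) t1 _; rewrite (meet_prefix my vb).
have [vE|vn] := eqVneq v y.
  rewrite vE leqnn; apply: (run_le (n := 1)) => //.
  apply: run_instr; first by [].
  split; last by rewrite /= /upd /= k1 // s4 vE.
  split=> // i ni; rewrite /= /upd; case: eqP => [?|_]; first by subst i.
  by apply: k1; move: ni; rewrite !inE !negb_or => /and5P[_ _ -> -> _].
have lty : size y < size v.
  by rewrite ltnNge; apply: contraNN vn => /(prefix_eq yv) ->.
rewrite leqNgt lty /=.
have j0 : 0 < j by case: (j) dj => //; rewrite expn0 addn1 ltnS leqNgt lty.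
have {}lj := lj j0.
have jE : jump v = take (size v - 2 ^ j.-1) v by rewrite /jump lj.
set w := jump v; have wv : prefix w v by rewrite /w jE prefix_take.
have wb := prefix_trans wv vb.
have lw : size w <= h by rewrite -bh prefix_size.
have sw : size w = size v - 2 ^ j.-1 by rewrite /w jE size_takel // leq_subr.
have p2 : 2 ^ j = 2 * 2 ^ j.-1 by rewrite -expnS prednK.
have p0 : 0 < 2 ^ j.-1 by rewrite expn_gt0.
apply: (run_cons (n := 8)); first by rewrite /= k1 // s4 m1 (st_jump st).
apply: (@run_seq _ _ _ _ _ 4 4).
set s2 := set_preg _ 10 _.
have st2 : static (hmem s2) by rewrite /= m1.
apply: run_mono (run_load_bounds (r := 10) (v := w) (s := s2) st2 _ _ lw) _ => //.
move=> s3 [[m3 k3] f8 f9].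
have t2 := eval_inside lw f8 f9.
have s34 : preg s3 4 = Some (B v) by rewrite k3 //= /upd /= k1.
have s35 : preg s3 5 = None by rewrite k3 //= /upd /= k1.
have m13 : hmem s3 = hmem s by rewrite m3 /= m1.
have kp s' : hmem s' = hmem s3 -> (forall i, i != 4 -> preg s' i = preg s3 i) ->
    keeps [:: 4; 5; 8; 9; 10] s s'.
  move=> mm kk; split=> [|i]; first by rewrite mm.
  rewrite !inE !negb_or => /and5P[i4 i5 i8 i9 i10].
  rewrite kk // k3 ?inE ?negb_or ?i8 ?i9 //= /upd (negbTE i10) k1 //.
  by rewrite !inE negb_or i8 i9.
(* The reference parent and the jump target of [v] are its two children in the preorder numbering,
   so either move lowers the level by one. *)
have lev j' : j.-1 = j'.+1 -> level n (h - size v).+1 = j.-1 /\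
    level n (h - size v + 2 ^ j.-1) = j.-1.
  by move=> E; rewrite E; apply: level_children; rewrite lj -E prednK.
apply: (run_if (n := 3)) t2 _; rewrite (meet_prefix my wb) sw.
(* A jump that stays below [y] takes [2 ^ j.-1] off the distance. Otherwise the distance is at most
   [2 ^ j.-1], and the parent is nearer by one. *)
case: (leqP (size v - 2 ^ j.-1) (size y)) => cmp; last first.
  apply: (run_le (n := 1)) => //; apply: run_instr; first by [].
  split; first by apply: kp => // i i4; rewrite /= /upd (negbTE i4).
  split=> //; exists w; split=> //.
  - by apply: prefix_total yv wv _; rewrite sw ltnW.
  - split.
      rewrite sw; move: cmp dj p0; rewrite p2.
      by move: (2 ^ j.-1) (size v) (size y) => e u1 u2; clear; lia.
    case E: j.-1 => [//|j'] _; have [_ L] := lev _ E.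
    rewrite -[RHS]E -[RHS]L; congr level; move: cmp lv p0; rewrite sw.
    by move: (2 ^ j.-1) (size v) (size y) => e u1 u2; clear; lia.
  - by rewrite /= /upd /= k3.
case/lastP E: v => [|v1 c]; first by rewrite E in lty.
have lv1 : size v1 < h by rewrite E size_rcons in lv.
have pv := static_parent c st lv1.
have [_ _ _ pA pD] := static_ptr st (ltnW lv1).
have pp : ptr (hmem s) PParent (if c then D v1 else A v1) = Some (B v1).
  by case: (c).
apply: (run_le (n := 2)) => //.
apply: (run_cons (n := 1)); first by rewrite /= s34 m13 E pv.
apply: run_instr; first by rewrite /= /upd /= m13 pp.
have v1b : prefix v1 b by rewrite E in vb; apply: prefix_rconsl vb.
split; first by apply: kp => // i i4; rewrite /= /upd (negbTE i4).
split=> //; exists v1; split=> //.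
- by apply: prefix_total yb v1b _; move: lty; rewrite E size_rcons.
- have sv : size v = (size v1).+1 by rewrite E size_rcons.
  split.
    move: cmp p0; rewrite sv.
    by move: (2 ^ j.-1) (size v1) (size y) => e u1 u2; clear; lia.
  case E': j.-1 => [//|j'] _; have [L _] := lev _ E'.
  rewrite -[RHS]E' -[RHS]L; congr level.
  by move: lv; rewrite sv; move: (size v1) => u1; clear; lia.
Qed.

Lemma run_meet_loop y b u v j s : meet y b -> static (hmem s) -> size b = h ->
  prefix u y -> prefix y v -> prefix v b -> within j y v ->
  preg s 2 = Some (B u) -> preg s 3 = Some (B b) -> preg s 4 = Some (B v) ->
  preg s 5 = None ->
  run W x (22 * (minn (size y - size u) j).+1).+1 meet_loop s (fun s' =>
    keeps [:: 2; 4; 5; 6; 7; 8; 9; 10] s s' /\ preg s' 5 = Some (B y)).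
Proof.
move=> my st bh; move E: (size y - size u) => e.
elim: e u v j s E st => [|e IH] u v j s E st uy yv vb wj s2 s3 s4 s5.
all: have ev s' : preg s' 5 = None -> eval_test x s' (TNil 5) = Some true
       by move=> /= ->.
all: have ev' s' : preg s' 5 = Some (B y) -> eval_test x s' (TNil 5) = Some false
       by move=> /= ->.
all: have H1 := run_step_down my st bh uy s2 s3 s5.
  have uE : u = y by apply: (prefix_eq uy); rewrite -subn_eq0 E.
  rewrite uE eqxx in H1; apply: (run_le (n := (20 + 1).+1)); last by rewrite min0n.
  apply: run_while_loop (ev _ s5) _; apply: (@run_seq _ _ _ _ _ 5 15).
  apply: run_mono H1 _ => s1 [[m1 k1] f5].
  apply: (run_if (n := 14)) (ev' _ f5) _; apply: (run_le (n := 1)) => //.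
  apply: run_instr; first by [].
  apply: run_while_stop; first exact: ev'.
  split=> //; split=> // i ni; rewrite /= /upd; case: eqP => [?|_]; first by subst i.
  by apply: k1; apply: contra ni; rewrite !inE => /or4P[] ->; rewrite ?orbT.
have un : u != y by apply/eqP => uE; rewrite uE subnn in E.
rewrite (negbTE un) in H1.
(* The factor [(v != y)] removes the later rounds when the step up finds the meeting point in this
   one. *)
apply: (run_le (n := (20 + (22 * (minn e j.-1).+1 * (v != y)).+1).+1)); last first.
  have [_|vn] := eqVneq v y; first by rewrite muln0; lia.
  have [lt _] := wj; have : 0 < j.
    case: (j) lt => //; rewrite expn0 addn1 ltnS => le; move/negP: vn; case.
    by rewrite (prefix_eq yv le).
  by rewrite muln1; clear; lia.
apply: run_while_loop (ev _ s5) _; apply: (@run_seq _ _ _ _ _ 5 15).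
apply: run_mono H1 _ => s1 [[m1 k1] [f5 [c cy f2]]].
apply: (run_if (n := 14)) (ev _ f5) _ => /=.
have f4 : preg s1 4 = Some (B v) by rewrite k1.
have st1 : static (hmem s1) by rewrite m1.
apply: run_mono (run_step_up my st1 bh yv vb wj f4 f5) _ => s6 [[m6 k6]].
have k16 : keeps [:: 2; 4; 5; 6; 7; 8; 9; 10] s s6.
  by apply: (keeps_trans (conj m1 k1) (conj m6 k6)) => i; rewrite !inE;
    repeat case/orP; move=> ->; rewrite ?orbT.
have [vE g5|vn [g5 [v' [yv' vb' j0 wj' g4]]]] := eqVneq v y.
  by rewrite muln0; apply: run_while_stop => //; apply: ev'.
rewrite muln1.
have g2 : preg s6 2 = Some (B (rcons u c)) by rewrite k6.
have g3 : preg s6 3 = Some (B b) by rewrite k6 // k1.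
have st6 : static (hmem s6) by rewrite m6.
have E' : size y - size (rcons u c) = e.
  by rewrite size_rcons; move: E; move: (size y) (size u) => u1 u2; clear; lia.
apply: run_mono (IH _ _ _ _ E' st6 cy yv' vb' wj' g2 g3 g4 g5) _ => s7 [k7 ->].
by split=> //; apply: (keeps_trans k16 k7) => i.
Qed.

Variable bt : seq bool -> seq bool.
Hypothesis btP : bottoms h bt.

(* In an access that has reached t, the preferred children of the strict ancestors
   of t already point towards t; the bottom of the root is only set at the end. *)
Definition tops t m := ptr m PExtra (A t) = Some (B (bt t)) /\
  forall q c, size q < h ->
    (if prefix q t && (size q < size t) then ~~ prefix (rcons q c) t
     else ~~ prefix (rcons q c) (bt q)) ->
    ptr m PExtra (A (rcons q c)) = Some (B (bt (rcons q c))).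

(** Between accesses, bottoms are maintained at the starts of preferred paths: the root and the
    children not preferred by their parents. *)
Definition all_tops b m := ptr m PExtra (A [::]) = Some (B (b [::])) /\
  forall q c, size q < h -> ~~ prefix (rcons q c) (b q) ->
    ptr m PExtra (A (rcons q c)) = Some (B (b (rcons q c))).

(** From [t] down to [y] the preferred path already points towards [y], so only the child choice at
    [y] changes. The abandoned child lies on the old path and inherits its bottom by coherence. *)
Lemma tops_step t y c s : tops t (hmem s) -> meet y (bt t) -> size y < h ->
  prefix t y -> prefix (rcons y c) a ->
  tops (rcons y c)
    (hmem (set_ptr s PExtra (A (rcons y (~~ c))) (Some (B (bt t))))).
Proof.
move=> [et eq] [ya yb ym] ly ty ca.
have lt : size t <= h := leq_trans (prefix_size ty) (ltnW ly).
have sb := bot_size btP lt.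
have bE q : prefix t q -> prefix q (bt t) -> bt q = bt t.
  by move=> ? ?; apply: (bot_coherent btP).
have nc : ~~ prefix (rcons y c) (bt t) by have := ym c; rewrite ca.
have pc : prefix (rcons y (~~ c)) (bt t) by rewrite -(prefix_rcons_neg c yb) ?sb.
have lc c0 : size (rcons y c0) <= h by rewrite size_rcons.
split=> [|q c0 lq]; rewrite /= /upd.
  rewrite ifF; last by apply/eqP => /(kA_inj (lc _) (lc _)) /rcons_inj[]; case: (c).
  apply: eq => //; rewrite ltnNge (prefix_size ty) andbF bE //.
have lqc : size (rcons q c0) <= h by rewrite size_rcons.
case: eqP => [/(kA_inj lqc (lc _)) /rcons_inj[-> ->] _|].
  rewrite bE //.
  exact: prefix_trans ty (prefix_rcons _ _).
move=> nE; have {}nE : rcons q c0 <> rcons y (~~ c) by move=> E; apply: nE; rewrite E.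
move=> H; apply: eq => //; move: H.
have [/andP[qt ltq]|nqt] := boolP (prefix q t && (size q < size t)).
  have qy := prefix_trans qt ty; have qyc := prefix_trans qy (prefix_rcons y c).
  have -> : prefix q (rcons y c) && (size q < size (rcons y c)).
    by rewrite qyc size_rcons ltnS (leq_trans (ltnW ltq)) // prefix_size.
  by apply: contra => h1; apply: prefix_trans (prefix_trans h1 ty) (prefix_rcons _ _).
case: ifP => // /andP[qyc]; rewrite size_rcons ltnS => leqy.
have qy : prefix q y.
  exact: prefix_total qyc (prefix_rcons y c) leqy.
have tq : prefix t q.
  move: nqt; rewrite negb_and -leqNgt => /orP[nqt|]; last exact: prefix_total ty qy.
  apply: (prefix_total ty qy); rewrite leqNgt; apply: contra nqt => lt'.
  exact: prefix_total qy ty (ltnW lt').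
rewrite bE //; last exact: prefix_trans yb.
move=> h1; apply: contra h1 => h2.
have [eqs|] := eqVneq (size q) (size y).
  have E : q = y by apply: (prefix_eq qy); rewrite eqs.
  rewrite E in h2 nE *; case: (eqVneq c0 c) => [-> |ne]; first exact: prefix_refl.
  by case: nE; congr rcons; move: ne; case: (c0) (c) => -[].
move=> nqy; have ltqy : size q < size y by rewrite ltn_neqAle nqy.
apply: prefix_trans (prefix_rcons y c).
by apply: (prefix_total h2 yb); rewrite size_rcons.
Qed.

(** Once the preferred path from [t] runs through [a], the bottom of [a] is that of [t], so the
    stored pointers already agree with [rebottom bt a]. *)
Lemma tops_final t m : tops t m -> prefix t a -> prefix a (bt t) ->
  forall q c, size q < h -> ~~ prefix (rcons q c) (rebottom bt a q) ->
    ptr m PExtra (A (rcons q c)) = Some (B (rebottom bt a (rcons q c))).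
Proof.
move=> [et eq] ta ab q c lq.
have lt : size t <= h := leq_trans (prefix_size ta) (size_adr h Q x).
have bE p : prefix t p -> prefix p (bt t) -> bt p = bt t.
  by move=> ? ?; apply: (bot_coherent btP).
rewrite /rebottom (bE a) //; have [qa|nqa] := boolP (prefix q a); last first.
  have nca : prefix (rcons q c) a = false by apply: contraNF nqa; apply: prefix_rconsl.
  rewrite nca => H; apply: eq => //; rewrite ifF //.
  by apply: contraNF nqa => /andP[qt _]; apply: prefix_trans ta.
move=> ncb; have nca : ~~ prefix (rcons q c) a.
  by apply: contra ncb => h1; apply: prefix_trans ab.
rewrite (negbTE nca); apply: eq => //; case: ifP => [_|/negbT nqt].
  by apply: contra nca => h1; apply: prefix_trans ta.
rewrite bE //; last exact: prefix_trans ab.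
apply: (prefix_total ta qa); rewrite leqNgt; apply: contra nqt => ltq.
by rewrite ltq andbT (prefix_total qa ta (ltnW ltq)).
Qed.

Lemma changes_from_step i y : i <= y -> y < size a -> changed bt a (take y a) ->
  (changes_from bt a y.+1).+1 <= changes_from bt a i.
Proof.
move=> iy ya ch; rewrite /changes_from.
have -> : size a - i = (y - i) + (size a - y.+1).+1 by lia.
by rewrite iotaD map_cat count_cat /= subnKC // ch add1n leq_addl.
Qed.

(** Bound on the rounds left: one per level for the walks down, or [n.+1] for each remaining change
    and for the last path. *)
Definition phases (t : seq bool) := minn (size a - size t).+1
  ((changes_from bt a (size t)).+1 * n.+1).

Lemma run_find_meet t y s : static (hmem s) -> size t <= h -> meet y (bt t) ->
  prefix t y -> tops t (hmem s) -> preg s 2 = Some (B t) ->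
  run W x ((22 * (minn (size y - size t) n).+1).+1 + 2).+4 find_meet s (fun s' =>
    [/\ hmem s' = hmem s, preg s' 0 = preg s 0, preg s' 1 = preg s 1 &
     [/\ preg s' 3 = Some (B (bt t)), preg s' 5 = Some (B y),
       preg s' 6 = Some (A y) & preg s' 7 = Some (D y)]]).
Proof.
move=> st lt my ty [etop _] s2; have [ya yb ym] := my.
have sb := bot_size btP lt.
have ly : size y <= h by rewrite -sb prefix_size.
have [ptl _ _ _ _] := static_ptr st lt.
have [pyl pyr _ _ _] := static_ptr st ly.
apply: run_cons; first by rewrite /= s2 ptl.
apply: run_cons; first by rewrite /= etop.
apply: run_cons; first by [].
apply: run_cons; first by [].
apply: run_seq; set s1 := set_preg _ 5 None.
(* The bottom has height 0, the root of the preorder numbering, so the upward search starts at the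
   top level [n]. *)
have wn : within n y (bt t).
  rewrite /within sb subnn; split; first exact: leq_trans hn (leq_addl _ _).
  by case: (n).
have := @run_meet_loop y (bt t) t (bt t) n s1 my st sb ty yb (prefix_refl _) wn.
move=> /(_ s2 erefl erefl erefl) H; apply: run_mono H _ => s3 [[m3 k3] f5].
apply: run_cons; first by rewrite /= f5 m3 /= pyl.
apply: run_instr; first by rewrite /= /upd /= f5 m3 /= pyr.
split; rewrite /= /upd /=; [by rewrite m3 | by rewrite k3 | by rewrite k3 |].
by split; rewrite ?f5 //; rewrite k3.
Qed.

Definition phases_done s :=
  [/\ static (hmem s), preg s 0 = Some (B [::]), preg s 1 = Some (B a),
      preg s 3 = Some (B (bt a)) & forall q c, size q < h ->
      ~~ prefix (rcons q c) (rebottom bt a q) ->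
      ptr (hmem s) PExtra (A (rcons q c)) = Some (B (rebottom bt a (rcons q c)))].

Lemma run_phases t s : static (hmem s) -> prefix t a -> tops t (hmem s) ->
  preg s 0 = Some (B [::]) -> preg s 1 = None -> preg s 2 = Some (B t) ->
  run W x (40 * phases t).+1 (CWhile (TNil 1) phase) s phases_done.
Proof.
have la : size a <= h := size_adr h Q x.
move E: (size a - size t) => e; elim/ltn_ind: e t s E => e IH t s E st ta tp s0 s1 s2.
have lt : size t <= h := leq_trans (prefix_size ta) la.
have sb := bot_size btP lt; have [y my] := meet_ex a (bt t).
have {}my : meet y (bt t) by []; have [ya yb ym] := my.
have ty : prefix t y.
  apply: (prefix_total ta ya); rewrite -(meet_prefix my) //; exact: (bot_prefix btP).
have ly : size y <= h by rewrite -sb prefix_size.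
have H := run_find_meet st lt my ty tp s2.
pose M := (minn (size y - size t) n).+1; rewrite -/M in H.
have [yE|yn] := eqVneq y a.
  apply: (run_le (n := (((22 * M).+1 + 2).+4 + 3 + 1).+1)); last first.
    rewrite /phases /M yE; move: (changes_from _ _ _) (size a - size t) => e1 e2.
    by clear; case: (leqP e2 n) => h1; nia.
  apply: run_while_loop; first by rewrite /= s1.
  apply: run_seq; apply: run_mono H _ => s3 [m3 f0 f1 [f3 f5 f6 f7]].
  have no c : y != bt t -> (if c then (D y < x)%O else (x < A y)%O) = false.
    move=> nb; have lth : size y < h.
      rewrite ltn_neqAle ly andbT; apply: contraNN nb => /eqP yh.
      by apply/eqP/(prefix_eq yb); rewrite sb yh.
    rewrite -(prefix_adr_rcons x0 Qperf Qsort Qall c lth ya) -/a.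
    by apply/negP => /prefix_size; rewrite -yE size_rcons ltnn.
  (* With [y = a] the phase must stop: above depth [h] the key [x] is in no child range, and at
     depth [h] the registers 5 and 3 agree. *)
  have nn c : (if c then (D y < x)%O else (x < A y)%O) &&
      ~~ (Some (B y) == Some (B (bt t))) = false.
    have [->|nb] := eqVneq y (bt t); first by rewrite eqxx andbF.
    by rewrite no.
  have T1 : eval_test x s3 (TAnd (TSearchLt 6) (TNot (TSame 5 3))) = Some false.
    by rewrite -(nn false); apply: eval_and; rewrite /= ?f6 ?f5 ?f3.
  have T2 : eval_test x s3 (TAnd (t_gt 7) (TNot (TSame 5 3))) = Some false.
    by rewrite -(nn true); apply: eval_and; [exact: eval_gt | rewrite /= ?f5 ?f3].
  apply: (run_if (n := 2)) T1 _; apply: (run_if (n := 1)) T2 _.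
  apply: run_instr; first by [].
  apply: run_while_stop; first by rewrite /= /upd /= f5.
  have aE : bt a = bt t by apply: (bot_coherent btP) => //; rewrite -yE.
  split; rewrite /= ?m3 //; rewrite /upd /= ?f0 ?f5 ?yE ?aE //.
  by apply: tops_final tp ta _; rewrite -yE.
have lta : size y < size a.
  by rewrite ltnNge; apply: contraNN yn => /(prefix_eq ya) ->.
have lth := leq_trans lta la.
have [c ca] := prefix_strict ya lta.
have nyb : Some (B y) == Some (B (bt t)) = false.
  apply/eqP => -[/kB_inj] /(_ ly); rewrite sb leqnn => /(_ isT) yE.
  by rewrite yE sb ltnn in lth.
have [cl cr] := static_child st lth.
have lc c0 : size (rcons y c0) <= h by rewrite size_rcons.
have [pcl _ _ _ _] := static_ptr st (lc (~~ c)).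
have bE : bt y = bt t by apply: (bot_coherent btP).
(* The phase descends below [y] and consumes the change at [y], so either bound in [phases] pays for
   its [M] rounds. *)
have le_ph : M + phases (rcons y c) <= phases t.
  have ch : changed bt a (take (size y) a).
    have -> : take (size y) a = y by move: ya; rewrite prefixE => /eqP.
    have aE : take (size y).+1 a = rcons y c.
      by move: ca; rewrite prefixE size_rcons => /eqP.
    by rewrite /changed ya lta aE bE; have := ym c; rewrite ca.
  have := changes_from_step (prefix_size ty) lta ch.
  rewrite /phases /M size_rcons; move: (prefix_size ty) lta.
  move: (changes_from bt a (size y).+1) (changes_from bt a (size t)) => c1 c2.
  move: (size a) (size y) (size t) => u1 u2 u3; clear => h1 h2 h3.
  rewrite leq_min; apply/andP; split; first by lia.
  apply: (@leq_trans (n.+1 + c1.+1 * n.+1)).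
    by apply: leq_add; rewrite ?ltnS geq_minr.
  by rewrite -mulSn leq_mul2r ltnS h3 orbT.
pose cost := ((22 * M).+1 + 2).+4 + 6 + (40 * phases (rcons y c)).+1.
apply: (run_le (n := cost.+1)); last first.
  rewrite /cost; move: le_ph; rewrite /M.
  by move: (minn _ _) (phases _) (phases _) => u1 u2 u3; clear; lia.
rewrite {}/cost.
apply: run_while_loop; first by rewrite /= s1.
apply: run_seq; apply: run_mono H _ => s3 [m3 f0 f1 [f3 f5 f6 f7]].
have side0 := prefix_adr_rcons x0 Qperf Qsort Qall false lth ya.
have side1 := prefix_adr_rcons x0 Qperf Qsort Qall true lth ya.
have next s4 : hmem s4 = hmem (set_ptr s PExtra (A (rcons y (~~ c))) (Some (B (bt t)))) ->
    preg s4 0 = preg s3 0 -> preg s4 1 = preg s3 1 ->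
    preg s4 2 = Some (B (rcons y c)) ->
    run W x (40 * phases (rcons y c)).+1 (CWhile (TNil 1) phase) s4 phases_done.
  move=> m4 g0 g1 g2; apply: (IH (size a - size (rcons y c))) => //.
  - rewrite -E size_rcons; move: (prefix_size ty) lta.
    by move: (size a) (size y) (size t) => u1 u2 u3; clear; lia.
  - by rewrite m4; apply: static_save.
  - by rewrite m4; apply: tops_step.
  - by rewrite g0 f0.
  - by rewrite g1 f1.
case: c ca pcl next {le_ph} => ca pcl next.
- have nlt : (x < A y)%O = false.
    by rewrite -side0; apply/negP => /(prefix_rcons2 ca).
  have T1 : eval_test x s3 (TAnd (TSearchLt 6) (TNot (TSame 5 3))) = Some false.
    by rewrite /= f6 nlt.
  have T2 : eval_test x s3 (TAnd (t_gt 7) (TNot (TSame 5 3))) = Some true.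
    rewrite -[true]/(true && true) -{1}ca side1; apply: eval_and; first exact: eval_gt.
    by rewrite /= f5 f3 nyb.
  apply: (run_if (n := 5)) T1 _; apply: (run_if (n := 4)) T2 _.
  apply: run_cons; first by rewrite /= f7 m3 cr.
  apply: run_cons; first by rewrite /= /upd /= f6 m3 cl.
  apply: run_cons; first by rewrite /= /upd /= m3 pcl.
  apply: run_instr; first by rewrite /= /upd /= f3.
  by apply: next; rewrite /= /upd //= m3.
- have T1 : eval_test x s3 (TAnd (TSearchLt 6) (TNot (TSame 5 3))) = Some true.
    by rewrite /= f6 -side0 ca f5 f3 nyb.
  apply: (run_if (n := 5)) T1 _; apply: (run_le (n := 4)) => //.
  apply: run_cons; first by rewrite /= f6 m3 cl.
  apply: run_cons; first by rewrite /= /upd /= f7 m3 cr.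
  apply: run_cons; first by rewrite /= /upd /= m3 pcl.
  apply: run_instr; first by rewrite /= /upd /= f3.
  by apply: next; rewrite /= /upd //= m3.
Qed.

Definition heap_ok b m := static m /\ all_tops b m.

Lemma run_hybrid m : heap_ok bt m ->
  run W x (40 * phases [::] + 26) hybrid
    (Machine (upd (fun=> None) 0 (Some (B [::]))) (fun=> 0) m)
    (fun s' => [/\ heap_ok (rebottom bt a) (hmem s'), preg s' 0 = Some (B [::]) &
                   preg s' 1 = Some x]).
Proof.
move=> [st [e0 eq]]; have la : size a <= h := size_adr h Q x.
(* Here 24 is two instructions plus [3 * 7 + 1] steps of the final search. *)
apply: (run_le (n := ((40 * phases [::]).+1 + 24).+1)); last first.
  by move: (phases _) => u; clear; lia.
apply: run_cons; first by [].
apply: run_seq; set s := set_preg _ 2 _.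
have tp : tops [::] (hmem s) by split=> // q c lq; rewrite ltn0 andbF; apply: eq.
have := @run_phases [::] s st (prefix0s _) tp erefl erefl erefl.
move=> H; apply: run_mono H _ => s1 [st1 f0 f1 f3 ft].
have [pl _ _ _ _] := static_ptr st1 (leq0n h : size [::] <= h).
apply: run_cons; first by rewrite /= f0 pl.
apply: run_cons; first by rewrite /= /upd /= f3.
set s2 := set_ptr _ _ _ _.
have st2 : static (hmem s2) by apply: static_save.
have li := linked_qsub st2 la.
have so : sorted <%O (inorder (phys (qsub Q a))).
  by rewrite inorder_phys; apply: sorted_qsub.
have xa : x \in inorder (phys (qsub Q a)).
  by rewrite inorder_phys -(prefix_adr Qperf Qsort Qall x la) prefix_refl.
have H := run_search_down W li so xa f1.
apply: run_le (run_mono H _) _; last first.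
  by have := depth_adr x0 Qperf Qsort Qall x; rewrite -/a; clear; lia.
move=> s3 [[m3 k3] g1]; split=> //; last by rewrite k3.
rewrite m3; split=> //; split=> [|q c lq nq]; rewrite /= /upd.
  by rewrite eqxx /rebottom prefix0s.
rewrite ifF; first exact: ft.
have lqc : size (rcons q c) <= h by rewrite size_rcons.
by apply/eqP => /(kA_inj (q := [::]) lqc (leq0n h)) /(congr1 size); rewrite size_rcons.
Qed.

End Machine.

(** * Initial heap and competitiveness *)

Section InitialHeap.
Variable K : eqType.
Implicit Types (t : tree K) (y : K).

Fixpoint node_info (par : option K) t y : option (option K * option K * option K) :=
  if t is Node l k r then
    if y == k then Some (par, root_key l, root_key r)
    else if y \in inorder l then node_info (Some k) l y
    else node_info (Some k) r y
  else None.

Lemma linked_info k (m : heap k K) par t : uniq (inorder t) ->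
  {in inorder t, forall y, node_info par t y =
    Some (ptr m PParent y, ptr m PLeft y, ptr m PRight y)} ->
  linked m par (root_key t) t.
Proof.
elim: t par => //= l IHl a r IHr par; rewrite cat_uniq /= negb_or.
move=> /and3P[ul /andP[al /hasPn lr] /andP[ar ur]] H.
have := H a; rewrite mem_cat inE !eqxx orbT => /(_ isT) [<- <- <-]; split=> //.
- apply: IHl => // y yl; have := H y; rewrite mem_cat yl => /(_ isT).
  by rewrite ifF //; apply: contraNF al => /eqP<-.
- apply: IHr => // y yr; have := H y; rewrite mem_cat inE yr !orbT => /(_ isT).
  by rewrite (negbTE (lr _ yr)) ifF //; apply: contraNF ar => /eqP<-.
Qed.

End InitialHeap.

(** * The initial heap and the cost of a whole sequence *)

Section Server.
Variables (d : Order.disp_t) (K : finOrderType d).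
Variables (h : nat) (Q : qtree K) (x0 : K).
Hypothesis Qperf : perfect h.+1 Q.
Hypothesis Qsort : sorted <%O (keys Q).
Hypothesis Qall : forall x, x \in keys Q.
Variables (n : nat) (W : nat).
Hypothesis hn : h < 2 ^ n.
Implicit Types (x y : K) (X : seq K) (b : seq bool -> seq bool).

Definition extra0 y : option K :=
  let p := adr h Q y in
  if y == kB Q x0 p then Some (kB Q x0 (jump h n p))
  else if y == kC Q x0 p then lo Q x0 p
  else if y == kD Q x0 p then hi Q x0 p
  else Some (kB Q x0 (leftmost h p)).

Definition heap0 : heap 0 K :=
  Heap (fun f y =>
      match f, node_info None (phys Q) y with
      | PExtra, _ => extra0 y
      | PParent, Some (p, _, _) => p
      | PLeft, Some (_, l, _) => l
      | PRight, Some (_, _, r) => r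
      | _, None => None
      end)
    (fun _ _ => 0).

Lemma linked_heap0 : linked heap0 None (root_key (phys Q)) (phys Q).
Proof.
have u : uniq (inorder (phys Q)).
  by rewrite inorder_phys; apply: (sorted_uniq lt_trans ltxx).
apply: linked_info => // y yQ /=.
have : node_info None (phys Q) y != None.
  elim: (phys Q) (None : option K) yQ => //= l IHl a r IHr par.
  rewrite mem_cat inE; case: ifP => //= _.
  by case: ifP => [yl _|_ /=]; [apply: IHl | apply: IHr].
by case: (node_info _ _ _) => [[[]]|].
Qed.

Lemma heap0_ok : heap_ok h Q x0 n (leftmost h) heap0.
Proof.
have rk : root_key (phys Q) = Some (kB Q x0 [::]).
  by have := qsubE x0 Qperf (leq0n h : size [::] <= h) => /= ->.
have aq p := @adr_quad _ _ h Q x0 Qperf Qsort Qall p.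
have ql p := @quad_lt _ _ h Q x0 Qperf Qsort p.
have exA p : size p <= h -> extra0 (kA Q x0 p) = Some (kB Q x0 (leftmost h p)).
  move=> lp; have [eA _ _ _] := aq p lp; have [ab bc cd] := ql p lp.
  have ac := lt_trans ab bc; have ad := lt_trans ac cd.
  by rewrite /extra0 eA !lt_eqF.
split; first split=> [|p lp|p lp|p lp].
- by rewrite -rk; apply: linked_heap0.
- by have [_ eB _ _] := aq p lp; rewrite /= /extra0 eB eqxx.
- have [_ _ eC _] := aq p lp; have [ab bc cd] := ql p lp.
  by rewrite /= /extra0 eC eqxx gt_eqF.
- have [_ _ _ eD] := aq p lp; have [ab bc cd] := ql p lp.
  by rewrite /= /extra0 eD eqxx !gt_eqF // (lt_trans bc).
- by split=> [|q c lq _]; rewrite /= exA // size_rcons.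
Qed.

Lemma heap_ok_linked b m : heap_ok h Q x0 n b m ->
  linked m None (Some (kB Q x0 [::])) (phys Q).
Proof. by case=> -[]. Qed.

Fixpoint total_changes b X : nat :=
  if X is x :: X' then
    changes_from b (adr h Q x) 0 + total_changes (rebottom b (adr h Q x)) X'
  else 0.

(** The potential telescopes, and each access costs at least 1 because it touches the requested
    key. *)
Lemma total_changes_le b t X m : bottoms h b -> bst t -> bst_serves t X m ->
  total_changes b X <= potential h Q b t + 2 * m /\ size X <= m.
Proof.
move=> bP bt sv; elim: sv b bP bt => {t X m} [//|t x t' a X m acc sv IH] b bP bt /=.
have [A [aE bt' xA _]] := bst_access_transition bt acc.
have := potential_access x0 Qperf Qsort Qall bP bt acc.
have [] := IH _ (bottoms_rebottom (size_adr h Q x) bP) bt'.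
have : 0 < a by rewrite aE card_gt0; apply/set0Pn; exists x.
by move: (total_changes _ _) (changes_from _ _ _) (potential _ _ _ _) (potential _ _ _ _)
  => u1 u2 u3 u4; clear; lia.
Qed.

(** The constant is [40 + 26] from [run_hybrid]; the two bounds in [phases] give the worst-case and
    the amortised estimate. *)
Lemma hybrid_serves b m X : bottoms h b -> heap_ok h Q x0 n b m ->
  exists ts, [/\ ds_serves W hybrid (Store (Some (kB Q x0 [::])) m) X ts,
    all (fun t => t <= 66 * h.+1) ts &
    sumn ts <= 66 * n.+1 * (size X + total_changes b X)].
Proof.
elim: X b m => [|x X IH] b m bP ok.
  by exists [::]; split=> //; constructor.
have la := size_adr h Q x.
have [s' [t [ex le [ok' p0 p1]]]] := run_hybrid Qperf Qsort Qall W hn x bP ok.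
have [ts [sv al su]] := IH _ _ (bottoms_rebottom la bP) ok'.
exists (t :: ts); split=> /=.
- apply: (ds_serves_cons (s' := Store (preg s' 0) (Defs.mem s')) (t' := phys Q)) => //.
  + by exists s'.
  + split=> /=; [exact: bst_phys | rewrite p0; exact: heap_ok_linked ok' | by case].
  + by rewrite p0.
- rewrite al andbT; move: le; rewrite /phases subn0; move: la.
  by move: (size _) (_ * n.+1) => u1 u2; clear; lia.
- move: le su; rewrite /phases subn0 mulnDr.
  move: (size (adr _ _ _)) (changes_from _ _ _) (total_changes _ _) (sumn ts) (size X).
  by clear => u1 u2 u3 u4 u5; nia.
Qed.

End Server.

Theorem theorem2 :
  exists (k c C : nat) (prog : cmd k),
  forall (d : Order.disp_t) (S : finOrderType d), 4 <= #|S| ->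
  exists (T0 : tree S) (s0 : store k S),
    stores (#|S| ^ c) s0 T0 /\
    forall X : seq S, exists ts : seq nat,
      [/\ ds_serves (#|S| ^ c) prog s0 X ts,
          all (fun t => t <= C * lg #|S|) ts,
          sumn ts <= C * lg (lg #|S|) * OPT_from T0 X &
          #|S| <= size X -> sumn ts <= C * lg (lg #|S|) * OPT X].
Proof.
(* The nodes carry no integer fields and every word stays 0, so the word bound [#|S| ^ 0] suffices;
   792 is [66 * 3 * 4]. *)
exists 0, 0, 792, hybrid => d S n4.
pose s := sort <=%O (enum S).
have szs : size s = #|S| by rewrite size_sort -cardE.
have sos : sorted <%O s by rewrite sort_lt_sorted enum_uniq.
have als x : x \in s by rewrite mem_sort mem_enum.
have [x0 _] : exists x0 : S, x0 \in s.
  case E: s => [|x0 s']; last by exists x0; rewrite mem_head.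
  by move: n4; rewrite -szs E.
(* The largest [k] with [4 * (2 ^ k - 1) <= #|S|], as [perfect_build] requires. *)
pose k := trunc_log 2 (#|S| %/ 4).+1.
have k0 : 0 < k by rewrite trunc_log_gt0 /= ltnS divn_gt0.
have kle : 2 ^ k <= (#|S| %/ 4).+1 by apply: trunc_logP.
have klt : (#|S| %/ 4).+1 < 2 * 2 ^ k by rewrite -expnS; apply: trunc_log_ltn.
have klg : k <= lg #|S|.
  by apply: trunc_log_max => //; move: kle n4; move: (2 ^ k) => u; clear; lia.
pose h := k.-1; have hk : h.+1 = k by rewrite prednK.
pose Q := build k s; have Qk : keys Q = s by rewrite keys_build.
have Qperf : perfect h.+1 Q.
  rewrite hk; apply: perfect_build; rewrite szs.
  by move: kle klt; move: (2 ^ k) => u; clear; lia.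
have Qsort : sorted <%O (keys Q) by rewrite Qk.
have Qall x : x \in keys Q by rewrite Qk.
pose n := (lg k).+1.
have hn : h < 2 ^ n by rewrite hk ltnW // /n /lg trunc_log_ltn.
(* Since [#|S|] is at least 4, the double logarithm is at least 1 and absorbs the additive 2. *)
have lln : n.+1 <= 3 * lg (lg #|S|).
  have l1 : lg k <= lg (lg #|S|) by apply: leq_trunc_log.
  have l2 : 0 < lg (lg #|S|).
    rewrite trunc_log_gt0 /=; apply: (@trunc_log_max 2 #|S| 2) => //.
  by rewrite /n; move: l1 l2; move: (lg k) (lg (lg _)) => u1 u2; clear; lia.
have ok := heap0_ok x0 Qperf Qsort Qall n.
exists (phys Q), (Store (Some (kB Q x0 [::])) (heap0 h Q x0 n)); split.
  by split; [exact: bst_phys | exact: heap_ok_linked ok | case].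
move=> X; have [ts [sv al su]] :=
  hybrid_serves Qperf Qsort Qall (#|S| ^ 0) hn X (bottoms_leftmost h) ok.
(* [B] bounds the initial potential; [size X], [B] and [2 * m] add up to at most [4 * m]. *)
have bound m B : total_changes h Q (leftmost h) X <= B + 2 * m -> size X <= m ->
    B <= m -> sumn ts <= 792 * lg (lg #|S|) * m.
  move=> h1 h2 h3; apply: leq_trans su _.
  apply: (@leq_trans (66 * (3 * lg (lg #|S|)) * (4 * m))); last first.
    by move: (lg _) => u; clear; lia.
  apply: leq_mul; first by rewrite leq_mul2l lln.
  by move: (total_changes _ _ _ _) (size X) h1 h2 h3 => u1 u2; clear; lia.
exists ts; split=> //.
- apply: sub_all al => t /= lt; apply: leq_trans lt _.
  by rewrite hk; apply: leq_mul.
- have [+ _] := OPT_fromP X (bst_phys Qsort Qall); set m := OPT_from _ _ => sv0.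
  have [h1 h2] := total_changes_le x0 Qperf Qsort Qall (bottoms_leftmost h)
    (bst_phys Qsort Qall) sv0.
  apply: (bound m 0) => //; rewrite add0n; move: h1.
  by rewrite (potential_leftmost x0 Qperf Qsort Qall).
(* For a freely chosen initial tree the potential may start at up to [#|S|], which the length of
   [X], and hence the optimum, dominates. *)
- move=> nX; have [[t bt sv0] _] := OPTP X; move: sv0; set m := OPT _ => sv0.
  have [h1 h2] := total_changes_le x0 Qperf Qsort Qall (bottoms_leftmost h) bt sv0.
  apply: (bound m #|S|) => //; last exact: leq_trans nX h2.
  by apply: leq_trans h1 _; rewrite leq_add2r; apply: (potential_le_card x0).
Qed.
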